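(* $\mathsf{CT}^-+\mathsf{SeqInd}$ proves $\mathsf{DC}_{in}$. Consequently, $\mathsf{DC}_{out}$ and $\mathsf{DC}$ are equivalent over $\mathsf{CT}^-$, i.e. $\mathsf{CT}^-+\mathsf{DC}_{out}$ and $\mathsf{CT}^-+\mathsf{DC}$ have the same theorems.
   Context: Work in the language $\mathcal{L}_{PA}=\{S,+,\times,0\}$ of Peano Arithmetic $\mathsf{PA}$ with a standard Gödel coding of syntax inside $\mathsf{PA}$; syntactic objects are identified with their codes, and the formalised syntactic notions (arithmetical sentence, formula, variable, closed term, the numeral $\underline{x}$ of a number $x$, the value $\mathrm{val}(t)$ of a closed term $t$, substitution) are the standard ones. $\mathsf{CT}^-$ is the theory in $\mathcal{L}_{PA}\cup\{T\}$, $T$ a fresh unary predicate, consisting of $\mathsf{PA}$ (induction only for $\mathcal{L}_{PA}$-formulas) together with: (1) $\forall x\,(T(x)\to x$ is an arithmetical sentence$)$; (2) for all closed terms $s,t$: $T(s=t)\leftrightarrow \mathrm{val}(s)=\mathrm{val}(t)$; (3) for all arithmetical sentences $\phi,\psi$: $T(\neg\phi)\leftrightarrow\neg T\phi$, $T(\phi\vee\psi)\leftrightarrow(T\phi\vee T\psi)$, $T(\phi\wedge\psi)\leftrightarrow(T\phi\wedge T\psi)$; (4) for every arithmetical formula $\phi$ and variable $v$ such that $\exists v\phi$ (resp. $\forall v\phi$) is a sentence: $T(\exists v\phi)\leftrightarrow\exists x\,T\phi(\underline{x})$ and $T(\forall v\phi)\leftrightarrow\forall x\,T\phi(\underline{x})$;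 (5) (Regularity) for every arithmetical formula $\phi$ and all sequences of closed terms $\bar s,\bar t$ of the same length whose sequences of values are equal, $T\phi(\bar s)\leftrightarrow T\phi(\bar t)$. For a coded sequence $\bar\phi=(\phi_0,\dots,\phi_c)$ of arithmetical sentences, the disjunction $\bigvee\bar\phi=\bigvee_{i\le c}\phi_i$ is defined with parentheses grouped to the left: $\bigvee_{i\le 0}\phi_i=\phi_0$ and $\bigvee_{i\le c+1}\phi_i=(\bigvee_{i\le c}\phi_i)\vee\phi_{c+1}$. $\mathsf{DC}_{out}$: for every coded sequence $\bar\phi$ of arithmetical sentences, if $T(\bigvee\bar\phi)$ then $T(\phi_i)$ for some index $i$ of $\bar\phi$. $\mathsf{DC}_{in}$: for every coded sequence $\bar\phi$ of arithmetical sentences, if $T(\phi_i)$ for some index $i$ of $\bar\phi$, then $T(\bigvee\bar\phi)$. $\mathsf{DC}$ (disjunctive correctness) is the conjunction of $\mathsf{DC}_{out}$ and $\mathsf{DC}_{in}$. $\mathsf{SeqInd}$: for every coded finite sequence $s$, if $T(s_0)$ and $\forall i<\mathrm{lh}(s)-1\,(T(s_i)\to T(s_{i+1}))$, then $\forall j<\mathrm{lh}(s)\ T(s_j)$. *)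

(* Defs.v *)
From Stdlib Require Import List Arith.
Import ListNotations.

(** * First-order logic with equality over L_PA + {T}, de Bruijn style

    The logical constants are those of the arithmetical formulas whose codes
    the truth predicate ranges over; implication is [~ A \/ B]. *)

Inductive term : Type :=
| Var (n : nat)
| Zero
| Succ (t : term)
| Add (s t : term)
| Mul (s t : term).

Inductive form : Type :=
| Eq (s t : term)
| Tr (t : term)
| Neg (A : form)
| Or (A B : form)
| And (A B : form)
| Ex (A : form)
| All (A : form).

Definition Imp (A B : form) : form := Or (Neg A) B.
Definition Iff (A B : form) : form := And (Imp A B) (Imp B A).

Definition scons (t : term) (sigma : nat -> term) (n : nat) : term :=
  match n with 0 => t | S m => sigma m end.

Fixpoint tsubst (sigma : nat -> term) (t : term) : term :=
  match t with
  | Var n => sigma n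
  | Zero => Zero
  | Succ t => Succ (tsubst sigma t)
  | Add s t => Add (tsubst sigma s) (tsubst sigma t)
  | Mul s t => Mul (tsubst sigma s) (tsubst sigma t)
  end.

Definition up (sigma : nat -> term) : nat -> term :=
  scons (Var 0) (fun n => tsubst (fun m => Var (S m)) (sigma n)).

Fixpoint fsubst (sigma : nat -> term) (A : form) : form :=
  match A with
  | Eq s t => Eq (tsubst sigma s) (tsubst sigma t)
  | Tr t => Tr (tsubst sigma t)
  | Neg A => Neg (fsubst sigma A)
  | Or A B => Or (fsubst sigma A) (fsubst sigma B)
  | And A B => And (fsubst sigma A) (fsubst sigma B)
  | Ex A => Ex (fsubst (up sigma) A)
  | All A => All (fsubst (up sigma) A)
  end.

Definition shift (A : form) : form := fsubst (fun n => Var (S n)) A.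
Definition inst (A : form) (t : term) : form := fsubst (scons t Var) A.

(** Classical natural deduction. *)
Inductive derives : list form -> form -> Prop :=
| d_ass G A : In A G -> derives G A
| d_negI G A B : derives (A :: G) B -> derives (A :: G) (Neg B) -> derives G (Neg A)
| d_raa G A B :
    derives (Neg A :: G) B -> derives (Neg A :: G) (Neg B) -> derives G A
| d_andI G A B : derives G A -> derives G B -> derives G (And A B)
| d_andE1 G A B : derives G (And A B) -> derives G A
| d_andE2 G A B : derives G (And A B) -> derives G B
| d_orI1 G A B : derives G A -> derives G (Or A B)
| d_orI2 G A B : derives G B -> derives G (Or A B)
| d_orE G A B C :
    derives G (Or A B) -> derives (A :: G) C -> derives (B :: G) C -> derives G C
| d_allI G A : derives (map shift G) A -> derives G (All A)
| d_allE G A t : derives G (All A) -> derives G (inst A t)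
| d_exI G A t : derives G (inst A t) -> derives G (Ex A)
| d_exE G A B :
    derives G (Ex A) -> derives (A :: map shift G) (shift B) -> derives G B
| d_eqI G t : derives G (Eq t t)
| d_eqE G A s t : derives G (Eq s t) -> derives G (inst A s) -> derives G (inst A t).

Definition theory : Type := form -> Prop.

Definition proves (Th : theory) (A : form) : Prop :=
  exists G : list form, (forall B, In B G -> Th B) /\ derives G A.

Definition extend (Th : theory) (A : form) : theory := fun B => Th B \/ B = A.

(** * Peano Arithmetic *)

Fixpoint arithmetical (A : form) : Prop :=
  match A with
  | Eq _ _ => True
  | Tr _ => False
  | Neg A => arithmetical A
  | Or A B | And A B => arithmetical A /\ arithmetical B
  | Ex A | All A => arithmetical A
  end.

Fixpoint term_below (k : nat) (t : term) : Prop :=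
  match t with
  | Var n => n < k
  | Zero => True
  | Succ t => term_below k t
  | Add s t | Mul s t => term_below k s /\ term_below k t
  end.

(** All free de Bruijn indices of the formula are below [k]. *)
Fixpoint form_below (k : nat) (A : form) : Prop :=
  match A with
  | Eq s t => term_below k s /\ term_below k t
  | Tr t => term_below k t
  | Neg A => form_below k A
  | Or A B | And A B => form_below k A /\ form_below k B
  | Ex A | All A => form_below (S k) A
  end.

(** The induction variable is index 0; the other indices are parameters. *)
Definition induction_for (A : form) : form :=
  Imp (And (inst A Zero)
           (All (Imp A (fsubst (scons (Succ (Var 0)) (fun n => Var (S n))) A))))
      (All A).

Inductive PA : theory :=
| PA_succ_nonzero : PA (All (Neg (Eq Zero (Succ (Var 0)))))
| PA_succ_inj :
    PA (All (All (Imp (Eq (Succ (Var 1)) (Succ (Var 0))) (Eq (Var 1) (Var 0)))))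
| PA_add_zero : PA (All (Eq (Add (Var 0) Zero) (Var 0)))
| PA_add_succ :
    PA (All (All (Eq (Add (Var 1) (Succ (Var 0))) (Succ (Add (Var 1) (Var 0))))))
| PA_mul_zero : PA (All (Eq (Mul (Var 0) Zero) Zero))
| PA_mul_succ :
    PA (All (All (Eq (Mul (Var 1) (Succ (Var 0))) (Add (Mul (Var 1) (Var 0)) (Var 1)))))
| PA_induction (k : nat) (A : form) :
    arithmetical A -> form_below (S k) A ->
    PA (Nat.iter k All (induction_for A)).

(** * Writing concrete formulas

    To avoid explicit de Bruijn indices, a term or formula is written as a
    function of the number [n] of binders above it.  The variable introduced
    by the binder at depth [k] is index [n - (k + 1)] at depth [n].  A sentence
    is read off at depth 0. *)

Definition tm : Type := nat -> term.
Definition fm : Type := nat -> form.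

Declare Scope tm_scope.
Declare Scope fm_scope.
Delimit Scope tm_scope with tm.
Delimit Scope fm_scope with fm.
Bind Scope tm_scope with tm.
Bind Scope fm_scope with fm.

Definition level (k : nat) : tm := fun n => Var (n - S k).

Definition suc (x : tm) : tm := fun n => Succ (x n).
Definition add (x y : tm) : tm := fun n => Add (x n) (y n).
Definition mul (x y : tm) : tm := fun n => Mul (x n) (y n).
Fixpoint num (k : nat) : tm :=
  match k with 0 => fun _ => Zero | S k => suc (num k) end.

Definition eqf (x y : tm) : fm := fun n => Eq (x n) (y n).
Definition T (x : tm) : fm := fun n => Tr (x n).
Definition negf (A : fm) : fm := fun n => Neg (A n).
Definition orf (A B : fm) : fm := fun n => Or (A n) (B n).
Definition andf (A B : fm) : fm := fun n => And (A n) (B n).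
Definition impf (A B : fm) : fm := fun n => Imp (A n) (B n).
Definition ifff (A B : fm) : fm := fun n => Iff (A n) (B n).
Definition exf (A : tm -> fm) : fm := fun n => Ex (A (level n) (S n)).
Definition allf (A : tm -> fm) : fm := fun n => All (A (level n) (S n)).

Notation "x + y" := (add x y) : tm_scope.
Notation "x * y" := (mul x y) : tm_scope.
Notation "x = y" := (eqf x y) : fm_scope.
Notation "~ A" := (negf A) : fm_scope.
Notation "A \/ B" := (orf A B) : fm_scope.
Notation "A /\ B" := (andf A B) : fm_scope.
Notation "A ==> B" := (impf A B) (at level 90, right associativity) : fm_scope.
Notation "A <-> B" := (ifff A B) : fm_scope.
Notation "∃ x .. y , A" := (exf (fun x => .. (exf (fun y => A)) ..))
  (at level 200, x binder, y binder, right associativity) : fm_scope.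
Notation "∀ x .. y , A" := (allf (fun x => .. (allf (fun y => A)) ..))
  (at level 200, x binder, y binder, right associativity) : fm_scope.

Definition ltf (x y : tm) : fm := (∃ z, x + suc z = y)%fm.
Notation "x < y" := (ltf x y) : fm_scope.

Local Open Scope fm_scope.

(** * Coded finite sequences

    Pairs are coded by (x + y)^2 + x + 1, which is injective and exceeds both
    components.  A sequence of length [l] is coded by a triple (l, (a, b)), its
    [i]th entry for [i < l] being Goedel's beta function
    a mod (1 + (i + 1) b). *)

Definition cpair (x y : tm) : tm := suc ((x + y) * (x + y) + x).

Definition beta (a b i x : tm) : fm :=
  (∃ q, a = q * suc (suc i * b) + x) /\ x < suc (suc i * b).

Definition lh (s l : tm) : fm := ∃ a b, s = cpair l (cpair a b).

Definition entry (s i x : tm) : fm :=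
  ∃ l a b, s = cpair l (cpair a b) /\ i < l /\ beta a b i x.

Definition is_seq (s : tm) : fm := ∃ l, lh s l.

Definition earlier (s i x : tm) : fm := ∃ j, j < i /\ entry s j x.

(** [x] is the last entry of a coded sequence each of whose entries is obtained
    from earlier ones by [step]; the first argument of [step] is membership
    among the earlier entries. *)
Definition built (step : (tm -> fm) -> tm -> fm) (x : tm) : fm :=
  ∃ s l, lh s (suc l) /\ entry s l x /\
    ∀ i y, entry s i y ==> step (earlier s i) y.

(** * Coded syntax of L_PA, with named variables v_0, v_1, ... *)

Definition cvar (i : tm) : tm := cpair (num 0) i.
Definition czero : tm := cpair (num 1) (num 0).
Definition csucc (t : tm) : tm := cpair (num 2) t.
Definition cadd (s t : tm) : tm := cpair (num 3) (cpair s t).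
Definition cmul (s t : tm) : tm := cpair (num 4) (cpair s t).
Definition ceq (s t : tm) : tm := cpair (num 5) (cpair s t).
Definition cneg (x : tm) : tm := cpair (num 6) x.
Definition cor (x y : tm) : tm := cpair (num 7) (cpair x y).
Definition cand (x y : tm) : tm := cpair (num 8) (cpair x y).
Definition cex (v x : tm) : tm := cpair (num 9) (cpair v x).
Definition call (v x : tm) : tm := cpair (num 10) (cpair v x).

Definition is_var (v : tm) : fm := ∃ i, v = cvar i.

Definition is_term : tm -> fm := built (fun prev x =>
  x = czero \/ is_var x
  \/ (∃ y, prev y /\ x = csucc y)
  \/ (∃ y z, prev y /\ prev z /\ (x = cadd y z \/ x = cmul y z))).

Definition is_form : tm -> fm := built (fun prev x =>
  (∃ s t, is_term s /\ is_term t /\ x = ceq s t)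
  \/ (∃ y, prev y /\ x = cneg y)
  \/ (∃ y z, prev y /\ prev z /\ (x = cor y z \/ x = cand y z))
  \/ (∃ v y, is_var v /\ prev y /\ (x = cex v y \/ x = call v y))).

(** [y] is an immediate subexpression of [x], and [x] does not bind [v]. *)
Definition below_avoiding (v x y : tm) : fm :=
  x = csucc y \/ x = cneg y
  \/ (∃ z, x = cadd y z \/ x = cadd z y \/ x = cmul y z \/ x = cmul z y
        \/ x = ceq y z \/ x = ceq z y \/ x = cor y z \/ x = cor z y
        \/ x = cand y z \/ x = cand z y)
  \/ (∃ w, ~ w = v /\ (x = cex w y \/ x = call w y)).

(** A free occurrence of the variable [v] in [x] is a path in the syntax tree
    from [x] to [v] along which no quantifier binds [v]. *)
Definition free_in (v x : tm) : fm :=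
  ∃ s l, lh s (suc l) /\ entry s (num 0) x /\ entry s l v /\
    ∀ i y z, entry s i y /\ entry s (suc i) z ==> below_avoiding v y z.

Definition is_clterm (t : tm) : fm :=
  is_term t /\ ∀ v, is_var v ==> ~ free_in v t.

Definition is_sent (x : tm) : fm :=
  is_form x /\ ∀ v, is_var v ==> ~ free_in v x.

(** val(t) = x *)
Definition val (t x : tm) : fm := built (fun prev p =>
  p = cpair czero (num 0)
  \/ (∃ s y, prev (cpair s y) /\ p = cpair (csucc s) (suc y))
  \/ (∃ s y s' y', prev (cpair s y) /\ prev (cpair s' y') /\
        (p = cpair (cadd s s') (y + y') \/ p = cpair (cmul s s') (y * y'))))
  (cpair t x).

(** [t] is the numeral of [x]. *)
Definition numeral (x t : tm) : fm := built (fun prev p =>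
  p = cpair (num 0) czero
  \/ (∃ y s, prev (cpair y s) /\ p = cpair (suc y) (csucc s)))
  (cpair x t).

(** [y] is the result of replacing the free occurrences of the variable [v] in
    [x] by [t].  It is used only for closed [t], so no capture can occur. *)
Definition csubst (x v t y : tm) : fm := built (fun prev p =>
  p = cpair v t
  \/ (∃ w, is_var w /\ ~ w = v /\ p = cpair w w)
  \/ p = cpair czero czero
  \/ (∃ a b, prev (cpair a b) /\
        (p = cpair (csucc a) (csucc b) \/ p = cpair (cneg a) (cneg b)))
  \/ (∃ a b a' b', prev (cpair a b) /\ prev (cpair a' b') /\
        (p = cpair (cadd a a') (cadd b b') \/ p = cpair (cmul a a') (cmul b b')
         \/ p = cpair (ceq a a') (ceq b b') \/ p = cpair (cor a a') (cor b b')
         \/ p = cpair (cand a a') (cand b b')))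
  \/ (∃ w a b, is_var w /\ ~ w = v /\ prev (cpair a b) /\
        (p = cpair (cex w a) (cex w b) \/ p = cpair (call w a) (call w b)))
  \/ (∃ a, p = cpair (cex v a) (cex v a) \/ p = cpair (call v a) (call v a)))
  (cpair x y).

(** [y] is the result of substituting the closed terms [ts] for the variables
    [vs] in [x].  For closed terms and distinct variables, substituting one
    after the other is simultaneous substitution. *)
Definition csubst_seq (x vs ts y : tm) : fm :=
  ∃ l u, lh vs l /\ lh ts l /\ lh u (suc l) /\
    entry u (num 0) x /\ entry u l y /\
    ∀ i v t z, entry vs i v /\ entry ts i t /\ entry u i z ==>
      ∃ z', csubst z v t z' /\ entry u (suc i) z'.

(** * The theory CT^- *)

(** T(x(n)), with the numeral of [n] substituted for [v] in [x] *)
Definition T_at (x v n : tm) : fm := ∃ t y, numeral n t /\ csubst x v t y /\ T y.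

Definition CT_sent : form := (∀ x, T x ==> is_sent x) 0.

Definition CT_eq : form :=
  (∀ s t, is_clterm s /\ is_clterm t ==>
     (T (ceq s t) <-> ∃ x, val s x /\ val t x)) 0.

Definition CT_neg : form :=
  (∀ x, is_sent x ==> (T (cneg x) <-> ~ T x)) 0.

Definition CT_or : form :=
  (∀ x y, is_sent x /\ is_sent y ==> (T (cor x y) <-> T x \/ T y)) 0.

Definition CT_and : form :=
  (∀ x y, is_sent x /\ is_sent y ==> (T (cand x y) <-> T x /\ T y)) 0.

Definition CT_ex : form :=
  (∀ x v, is_form x /\ is_var v /\ is_sent (cex v x) ==>
     (T (cex v x) <-> ∃ n, T_at x v n)) 0.

Definition CT_all : form :=
  (∀ x v, is_form x /\ is_var v /\ is_sent (call v x) ==>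
     (T (call v x) <-> ∀ n, T_at x v n)) 0.

Definition seq_of (P : tm -> fm) (s : tm) : fm :=
  is_seq s /\ ∀ i x, entry s i x ==> P x.

(** [vs] lists without repetition variables including all those free in [x]. *)
Definition lists_free_vars (vs x : tm) : fm :=
  seq_of is_var vs
  /\ (∀ i j v, entry vs i v /\ entry vs j v ==> i = j)
  /\ (∀ v, is_var v /\ free_in v x ==> ∃ i, entry vs i v).

Definition same_values (ss ts : tm) : fm :=
  (∃ l, lh ss l /\ lh ts l)
  /\ ∀ i s t, entry ss i s /\ entry ts i t ==> ∃ n, val s n /\ val t n.

Definition CT_regularity : form :=
  (∀ x vs ss ts y z,
     is_form x /\ lists_free_vars vs x
     /\ seq_of is_clterm ss /\ seq_of is_clterm ts /\ same_values ss ts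
     /\ csubst_seq x vs ss y /\ csubst_seq x vs ts z ==>
     (T y <-> T z)) 0.

Definition CT_minus : theory := fun A =>
  (PA A
  \/ In A [CT_sent; CT_eq; CT_neg; CT_or; CT_and; CT_ex; CT_all; CT_regularity])%type.

(** * Disjunctive correctness and sequential induction *)

(** [d] is the disjunction, grouped to the left, of the nonempty sequence [s]. *)
Definition disjunction (s d : tm) : fm :=
  ∃ c u, lh s (suc c) /\ lh u (suc c)
    /\ (∃ x, entry s (num 0) x /\ entry u (num 0) x)
    /\ (∀ i x y, entry u i x /\ entry s (suc i) y ==> entry u (suc i) (cor x y))
    /\ entry u c d.

Definition T_disjunction (s : tm) : fm := ∃ d, disjunction s d /\ T d.

(** T(s_i); false when [i] is not an index of [s]. *)
Definition T_entry (s i : tm) : fm := ∃ x, entry s i x /\ T x.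

Definition DC_out : form :=
  (∀ s, seq_of is_sent s ==> T_disjunction s ==> ∃ i, T_entry s i) 0.

Definition DC_in : form :=
  (∀ s, seq_of is_sent s ==> (∃ i, T_entry s i) ==> T_disjunction s) 0.

Definition DC : form := And DC_out DC_in.

Definition SeqInd : form :=
  (∀ s l, lh s l ==>
     T_entry s (num 0)
     /\ (∀ i, suc i < l ==> T_entry s i ==> T_entry s (suc i)) ==>
     ∀ j, j < l ==> T_entry s j) 0.

(* Main.v *)
From Stdlib Require Import List Arith Lia Ring.
From Stdlib Require Import Classical ClassicalEpsilon FunctionalExtensionality.
From Stdlib Require Import PropExtensionality ProofIrrelevance Cantor.
Require Import Defs.
Import ListNotations.

(** The deductive claims are proved by reasoning in models: by the completeness theorem it
    suffices to show that every model of CT^- satisfying DC_out (or SeqInd) satisfies DC_in.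
    In a model of PA, Goedel's beta function codes every arithmetically definable sequence,
    so coded sequences of sentences can be built by recursion.  DC_out yields SeqInd for
    sequences s of sentences: if s_0 is true, truth passes from s_i to s_(i+1) and s_j is
    false, then the disjunction E_j with E_0 = s_j and
    E_(i+1) = E_i \/ (s_(j-i-1) /\ ~ E_i) is true, because s_0 is, but none of its disjuncts
    is.  SeqInd applied to the partial disjunctions of a sequence, starting at a true
    disjunct, gives DC_in. *)

(** * Substitution *)

(** The truth of a long disjunction therefore cannot be followed through its partial disjunctions,
    and every argument about truth may use the truth clauses only boundedly often. This dictates the
    shape of E. By the clauses alone E_(i+1) is equivalent to E_i \/ s_(j-i-1), yet the conjunct ~
    E_i changes what a true disjunct says: it singles out a step at which s_(j-i-1) is true and E_i
    is not, and such a step contradicts a single instance of the hypothesis on s. The plain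
    disjunction of the s_i would have the true disjunct s_0 and give no contradiction. The sequence
    is read backwards so that the false s_j is the innermost disjunct and s_0 enters at the
    outermost connective, where one use of the clauses reaches it. Being an entry, being a sentence
    and having a code are arithmetical, so ordinary induction remains available for all of these.
    Working in models lets nonstandard lengths be handled as ordinary elements and avoids writing
    formal derivations. *)

Lemma tsubst_comp (sigma tau : nat -> term) (t : term) :
  tsubst sigma (tsubst tau t) = tsubst (fun n => tsubst sigma (tau n)) t.
Proof. induction t; simpl; congruence. Qed.

Lemma tsubst_var (t : term) : tsubst Var t = t.
Proof. induction t; simpl; congruence. Qed.

Lemma up_comp (sigma tau : nat -> term) :
  (fun n => tsubst (up sigma) (up tau n)) = up (fun n => tsubst sigma (tau n)).
Proof.
  extensionality n; destruct n as [|n]; [reflexivity|].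
  unfold up at 2 3; simpl; now rewrite !tsubst_comp.
Qed.

Lemma fsubst_comp (A : form) : forall sigma tau : nat -> term,
  fsubst sigma (fsubst tau A) = fsubst (fun n => tsubst sigma (tau n)) A.
Proof.
  induction A; intros; simpl; f_equal; rewrite <- ?up_comp; auto using tsubst_comp.
Qed.

Lemma fsubst_up_shift (sigma : nat -> term) (A : form) :
  fsubst (up sigma) (shift A) = shift (fsubst sigma A).
Proof. unfold shift; rewrite !fsubst_comp; reflexivity. Qed.

Lemma fsubst_inst (sigma : nat -> term) (A : form) (t : term) :
  fsubst sigma (inst A t) = inst (fsubst (up sigma) A) (tsubst sigma t).
Proof.
  unfold inst; rewrite !fsubst_comp; f_equal.
  extensionality n; destruct n as [|n]; simpl; [reflexivity|].
  rewrite tsubst_comp; simpl; now rewrite tsubst_var.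
Qed.

Lemma inst_fsubst_up (sigma : nat -> term) (A : form) (t : term) :
  inst (fsubst (up sigma) A) t = fsubst (scons t sigma) A.
Proof.
  unfold inst; rewrite fsubst_comp; f_equal.
  extensionality n; destruct n as [|n]; simpl; [reflexivity|].
  rewrite tsubst_comp; simpl; now rewrite tsubst_var.
Qed.

Lemma tsubst_below (k : nat) (sigma tau : nat -> term) (t : term) :
  (forall n, n < k -> sigma n = tau n) -> term_below k t -> tsubst sigma t = tsubst tau t.
Proof.
  intro H; induction t; simpl; intuition; f_equal; auto.
Qed.

Lemma fsubst_below (A : form) : forall (k : nat) (sigma tau : nat -> term),
  (forall n, n < k -> sigma n = tau n) -> form_below k A -> fsubst sigma A = fsubst tau A.
Proof.
  assert (Hup : forall k (sigma tau : nat -> term),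
    (forall n, n < k -> sigma n = tau n) -> forall n, n < S k -> up sigma n = up tau n).
  { intros k sigma tau H [|n] Hn; [reflexivity|].
    unfold up; simpl; rewrite H; [reflexivity | lia]. }
  induction A; simpl; intros k sigma tau H HA; f_equal;
    try (eapply tsubst_below; intuition eauto; fail);
    intuition eauto.
Qed.

Lemma up_var : up Var = Var.
Proof. extensionality n; destruct n; reflexivity. Qed.

Lemma fsubst_var (A : form) : fsubst Var A = A.
Proof. induction A; simpl; rewrite ?up_var, ?tsubst_var; congruence. Qed.

Lemma fsubst_closed (sigma : nat -> term) (A : form) : form_below 0 A -> fsubst sigma A = A.
Proof.
  intro H; rewrite <- (fsubst_var A) at 2.
  apply (fsubst_below A 0); [lia | assumption].
Qed.

Lemma term_below_mono (k k' : nat) (t : term) : k <= k' -> term_below k t -> term_below k' t.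
Proof. intro H; induction t; simpl; intuition lia. Qed.

Lemma form_below_mono (A : form) : forall k k' : nat,
  k <= k' -> form_below k A -> form_below k' A.
Proof.
  induction A; simpl; intros k k' H HA; intuition eauto using term_below_mono, le_n_S.
Qed.

Lemma term_bounded (t : term) : exists k, term_below k t.
Proof.
  induction t as [n| |t [k H]|s [k H] t [k' H']|s [k H] t [k' H']]; simpl.
  - exists (S n); lia.
  - now exists 0.
  - now exists k.
  - exists (Nat.max k k'); split; eapply term_below_mono; try eassumption; lia.
  - exists (Nat.max k k'); split; eapply term_below_mono; try eassumption; lia.
Qed.

Lemma form_bounded (A : form) : exists k, form_below k A.
Proof.
  induction A as [s t|t|A [k H]|A [k H] B [k' H']|A [k H] B [k' H']|A [k H]|A [k H]]; simpl.
  - destruct (term_bounded s) as [k H], (term_bounded t) as [k' H'].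
    exists (Nat.max k k'); split; eapply term_below_mono; try eassumption; lia.
  - apply term_bounded.
  - now exists k.
  - exists (Nat.max k k'); split; eapply form_below_mono; try eassumption; lia.
  - exists (Nat.max k k'); split; eapply form_below_mono; try eassumption; lia.
  - exists k; eapply form_below_mono; [|eassumption]; lia.
  - exists k; eapply form_below_mono; [|eassumption]; lia.
Qed.

Lemma tsubst_term_below (k k' : nat) (sigma : nat -> term) (t : term) :
  (forall n, n < k -> term_below k' (sigma n)) -> term_below k t ->
  term_below k' (tsubst sigma t).
Proof. intro H; induction t; simpl; intuition. Qed.

Lemma fsubst_form_below (A : form) : forall (k k' : nat) (sigma : nat -> term),
  (forall n, n < k -> term_below k' (sigma n)) -> form_below k A ->
  form_below k' (fsubst sigma A).
Proof.
  assert (Hup : forall k k' (sigma : nat -> term),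
    (forall n, n < k -> term_below k' (sigma n)) ->
    forall n, n < S k -> term_below (S k') (up sigma n)).
  { intros k k' sigma H [|n] Hn; simpl; [lia|].
    eapply tsubst_term_below; [|apply H; lia]; simpl; lia. }
  induction A; simpl; intros k k' sigma H HA; intuition eauto using tsubst_term_below.
Qed.

(** * Derivations *)

Lemma derives_weaken (G : list form) (A : form) :
  derives G A -> forall G', incl G G' -> derives G' A.
Proof.
  assert (Hc : forall (B : form) G G', incl G G' -> incl (B :: G) (B :: G')).
  { intros B G1 G2 H x [->|Hx]; [now left | right; auto]. }
  assert (Hm : forall G G', incl G G' -> incl (map shift G) (map shift G')).
  { intros G1 G2 H x Hx; apply in_map_iff in Hx as (y & <- & Hy).
    apply in_map; auto. }
  induction 1; intros G' HG.
  - apply d_ass; auto.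
  - apply d_negI with B; auto.
  - apply d_raa with B; auto.
  - apply d_andI; auto.
  - apply d_andE1 with B; auto.
  - apply d_andE2 with A; auto.
  - apply d_orI1; auto.
  - apply d_orI2; auto.
  - apply d_orE with A B; auto.
  - apply d_allI; auto.
  - apply d_allE; auto.
  - apply d_exI with t; auto.
  - apply d_exE with A; auto.
  - apply d_eqI.
  - apply d_eqE with s; auto.
Qed.

(** Free variables will serve as Henkin constants; this closure property is what allows a fresh one
    to be renamed into the index bound by a quantifier. *)
Lemma derives_subst (G : list form) (A : form) :
  derives G A -> forall sigma, derives (map (fsubst sigma) G) (fsubst sigma A).
Proof.
  assert (Hm : forall sigma G, map (fsubst (up sigma)) (map shift G)
                               = map shift (map (fsubst sigma) G)).
  { intros sigma G0; rewrite !map_map; apply map_ext; intro B; apply fsubst_up_shift. }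
  induction 1; intro sigma; simpl in *; rewrite ?fsubst_inst.
  - apply d_ass, in_map; assumption.
  - eapply d_negI; eauto.
  - eapply d_raa; eauto.
  - eapply d_andI; eauto.
  - eapply d_andE1; eauto.
  - eapply d_andE2; eauto.
  - eapply d_orI1; eauto.
  - eapply d_orI2; eauto.
  - eapply d_orE; eauto.
  - apply d_allI; rewrite <- Hm; auto.
  - apply d_allE; apply (IHderives sigma).
  - apply d_exI with (tsubst sigma t); rewrite <- fsubst_inst; auto.
  - apply d_exE with (fsubst (up sigma) A); [apply (IHderives1 sigma)|].
    rewrite <- Hm, <- fsubst_up_shift; apply (IHderives2 (up sigma)).
  - apply d_eqI.
  - apply d_eqE with (tsubst sigma s); [apply (IHderives1 sigma)|].
    rewrite <- fsubst_inst; auto.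
Qed.

Lemma derives_cut (G H : list form) (A : form) :
  (forall B, In B G -> derives H B) -> derives G A -> derives H A.
Proof.
  revert A; induction G as [|B G IH]; intros A HG HA.
  - eapply derives_weaken; [eassumption | intros x []].
  - assert (HI : derives G (Imp B A)).
    { apply d_raa with (Imp B A); [|apply d_ass; now left].
      apply d_orI1, d_negI with (Imp B A); [|apply d_ass; simpl; auto].
      apply d_orI2; eapply derives_weaken; [eassumption|].
      intros x [->|Hx]; simpl; auto. }
    apply d_orE with (Neg B) A.
    + apply IH; [intros; apply HG; now right | exact HI].
    + apply d_raa with B; [|apply d_ass; simpl; auto].
      eapply derives_weaken; [apply HG; now left|].
      intros x Hx; simpl; auto.
    + apply d_ass; now left.
Qed.

Lemma proves_cut (U V : theory) (A : form) :
  (forall B, U B -> proves V B) -> proves U A -> proves V A.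
Proof.
  intros HUV (G & HG & HA).
  assert (HV : exists H, (forall B, In B H -> V B) /\ forall B, In B G -> derives H B).
  { clear HA; induction G as [|B G IH].
    - exists []; split; intros ? [].
    - destruct IH as (H & HH & HD); [intros; apply HG; now right|].
      destruct (HUV B) as (H' & HH' & HB); [apply HG; now left|].
      exists (H' ++ H); split.
      + intros C HC; apply in_app_or in HC as [HC|HC]; auto.
      + intros C [<-|HC].
        * eapply derives_weaken; [eassumption | now apply incl_appl].
        * eapply derives_weaken; [apply HD, HC | now apply incl_appr]. }
  destruct HV as (H & HH & HD); exists H; split; [assumption|].
  now apply derives_cut with G.
Qed.

Lemma proves_ass (U : theory) (A : form) : U A -> proves U A.
Proof.
  intro H; exists [A]; split; [|apply d_ass; now left].
  now intros B [<-|[]].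
Qed.

Lemma proves_from1 (U : theory) (A B : form) : derives [A] B -> proves U A -> proves U B.
Proof.
  intros HD (G & HG & HA); exists G; split; [assumption|].
  apply derives_cut with [A]; [|assumption].
  now intros C [<-|[]].
Qed.

Lemma proves_from2 (U : theory) (A B C : form) :
  derives [A; B] C -> proves U A -> proves U B -> proves U C.
Proof.
  intros HD (G & HG & HA) (G' & HG' & HB); exists (G ++ G'); split.
  - intros D HD'; apply in_app_or in HD' as []; auto.
  - apply derives_cut with [A; B]; [|assumption].
    intros D [<-|[<-|[]]].
    + eapply derives_weaken; [eassumption | now apply incl_appl].
    + eapply derives_weaken; [eassumption | now apply incl_appr].
Qed.

Lemma proves_extend (U : theory) (A B : form) :
  proves (extend U A) B -> exists G, (forall C, In C G -> U C) /\ derives (A :: G) B.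
Proof.
  intros (G & HG & HB).
  assert (HI : exists G', (forall C, In C G' -> U C) /\ incl G (A :: G')).
  { clear HB; induction G as [|C G IH].
    - exists []; split; [intros ? [] | intros ? []].
    - destruct IH as (G' & HG' & Hi); [intros; apply HG; now right|].
      destruct (HG C) as [HC|HC]; [now left| |].
      + exists (C :: G'); split; [intros D [<-|HD]; auto|].
        intros D [<-|HD]; simpl; auto.
        destruct (Hi D HD); auto.
      + subst C; exists G'; split; [assumption|].
        intros D [<-|HD]; simpl; auto. apply Hi, HD. }
  destruct HI as (G' & HG' & Hi); exists G'; split; [assumption|].
  eapply derives_weaken; eassumption.
Qed.

(** * Structures with true equality *)

Record structure : Type := {
  carrier :> Type;
  izero : carrier;
  isucc : carrier -> carrier;
  iadd : carrier -> carrier -> carrier;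
  imul : carrier -> carrier -> carrier;
  itr : carrier -> Prop
}.

Arguments izero {_}.
Arguments isucc {_} _.
Arguments iadd {_} _ _.
Arguments imul {_} _ _.
Arguments itr {_} _.

Definition icons {X : Type} (a : X) (rho : nat -> X) (n : nat) : X :=
  match n with 0 => a | S m => rho m end.

Fixpoint eval {M : structure} (rho : nat -> M) (t : term) : M :=
  match t with
  | Var n => rho n
  | Zero => izero
  | Succ t => isucc (eval rho t)
  | Add s t => iadd (eval rho s) (eval rho t)
  | Mul s t => imul (eval rho s) (eval rho t)
  end.

Fixpoint sat {M : structure} (rho : nat -> M) (A : form) : Prop :=
  match A with
  | Eq s t => eval rho s = eval rho t
  | Tr t => itr (eval rho t)
  | Neg A => ~ sat rho A
  | Or A B => sat rho A \/ sat rho B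
  | And A B => sat rho A /\ sat rho B
  | Ex A => exists a, sat (icons a rho) A
  | All A => forall a, sat (icons a rho) A
  end.

Definition models (M : structure) (Th : theory) : Prop :=
  forall B, Th B -> forall rho : nat -> M, sat rho B.

Lemma eval_tsubst {M : structure} (rho : nat -> M) (sigma : nat -> term) (t : term) :
  eval rho (tsubst sigma t) = eval (fun n => eval rho (sigma n)) t.
Proof. induction t; simpl; congruence. Qed.

Lemma sat_fsubst {M : structure} (A : form) : forall (rho : nat -> M) (sigma : nat -> term),
  sat rho (fsubst sigma A) <-> sat (fun n => eval rho (sigma n)) A.
Proof.
  assert (Hup : forall (rho : nat -> M) sigma a,
    (fun n => eval (icons a rho) (up sigma n)) = icons a (fun n => eval rho (sigma n))).
  { intros rho sigma a; extensionality n; destruct n as [|n]; [reflexivity|].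
    unfold up; simpl; now rewrite eval_tsubst. }
  induction A; intros rho sigma; simpl; rewrite ?eval_tsubst.
  - reflexivity.
  - reflexivity.
  - now rewrite IHA.
  - now rewrite IHA1, IHA2.
  - now rewrite IHA1, IHA2.
  - split; intros [a Ha]; exists a.
    + rewrite IHA, Hup in Ha; exact Ha.
    + rewrite IHA, Hup; exact Ha.
  - split; intros H a; specialize (H a).
    + rewrite IHA, Hup in H; exact H.
    + rewrite IHA, Hup; exact H.
Qed.

(** * Completeness *)

Definition consistent (U : theory) : Prop := ~ exists B, proves U B /\ proves U (Neg B).

Lemma inconsistent_proves_neg (U : theory) (A : form) :
  ~ consistent (extend U A) -> proves U (Neg A).
Proof.
  intro H; apply NNPP in H as (B & HB & HnB).
  apply proves_extend in HB as (G & HG & HB).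
  apply proves_extend in HnB as (G' & HG' & HnB).
  exists (G ++ G'); split.
  - intros C HC; apply in_app_or in HC as []; auto.
  - apply d_negI with B; (eapply derives_weaken; [eassumption|]).
    + intros C [<-|HC]; [now left | right; apply in_or_app; auto].
    + intros C [<-|HC]; [now left | right; apply in_or_app; auto].
Qed.

Lemma derives_explode (A B : form) (G : list form) :
  derives G A -> derives G (Neg A) -> derives G B.
Proof.
  intros H1 H2; apply d_raa with A; (eapply derives_weaken; [eassumption|]);
    now apply incl_tl.
Qed.

(** If the instance were refutable, then, [m] being free neither in [U] nor in [Ex B], the
    refutation would apply to an arbitrary object and contradict [Ex B]. *)
Lemma extend_henkin_consistent (U : theory) (m : nat) (B : form) :
  (forall C, U C -> form_below m C) -> form_below m (Ex B) -> U (Ex B) ->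
  consistent U -> consistent (extend U (inst B (Var m))).
Proof.
  intros Hm HmB HB Hcon Hinc.
  assert (Hneg : proves U (Neg (inst B (Var m)))).
  { apply inconsistent_proves_neg; intro H; now apply H. }
  destruct Hneg as (G & HG & HD).
  apply Hcon; exists (Ex B); split; [now apply proves_ass|].
  exists G; split; [assumption|].
  (* [sigma] sends the fresh variable to index 0, the one opened by [d_exE], and acts as the shift
     below [m]. It therefore maps [G] to [map shift G] and the instance back to [B]. *)
  set (sigma n := if Nat.eqb n m then Var 0 else Var (S n)).
  apply (derives_subst _ _) with (sigma := sigma) in HD.
  replace (map (fsubst sigma) G) with (map shift G) in HD.
  2:{ apply map_ext_in; intros C HC; unfold shift.
      apply (fsubst_below C m); [|auto].
      intros n Hn; unfold sigma.
      destruct (Nat.eqb_spec n m); [lia | reflexivity]. }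
  replace (fsubst sigma (Neg (inst B (Var m)))) with (Neg B) in HD.
  2:{ simpl; f_equal; unfold inst; rewrite fsubst_comp.
      rewrite <- (fsubst_var B) at 1.
      apply (fsubst_below B (S m)); [|assumption].
      intros [|n] Hn; simpl; unfold sigma.
      - now rewrite Nat.eqb_refl.
      - destruct (Nat.eqb_spec n m); [lia | reflexivity]. }
  apply d_negI with (Ex B); [apply d_ass; now left|].
  apply d_exE with B; [apply d_ass; now left|].
  apply derives_explode with B; [apply d_ass; now left|].
  eapply derives_weaken; [eassumption|].
  intros x Hx; right; right; assumption.
Qed.

(** * Enumeration of formulas and choice of fresh variables *)

Fixpoint tcode (t : term) : nat :=
  match t with
  | Var n => to_nat (0, n)
  | Zero => to_nat (1, 0)
  | Succ t => to_nat (2, tcode t)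
  | Add s t => to_nat (3, to_nat (tcode s, tcode t))
  | Mul s t => to_nat (4, to_nat (tcode s, tcode t))
  end.

Fixpoint fcode (A : form) : nat :=
  match A with
  | Eq s t => to_nat (0, to_nat (tcode s, tcode t))
  | Tr t => to_nat (1, tcode t)
  | Neg A => to_nat (2, fcode A)
  | Or A B => to_nat (3, to_nat (fcode A, fcode B))
  | And A B => to_nat (4, to_nat (fcode A, fcode B))
  | Ex A => to_nat (5, fcode A)
  | All A => to_nat (6, fcode A)
  end.

Ltac inject_codes :=
  repeat match goal with
  | H : to_nat _ = to_nat _ |- _ => 
      apply to_nat_inj, pair_equal_spec in H as [? ?]
  end.

Lemma tcode_inj (s t : term) : tcode s = tcode t -> s = t.
Proof.
  revert t; induction s; destruct t; cbn [tcode]; intro H; inject_codes; subst;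
    try discriminate; f_equal; auto.
Qed.

Lemma fcode_inj (A B : form) : fcode A = fcode B -> A = B.
Proof.
  revert B; induction A; destruct B; cbn [fcode]; intro H; inject_codes; subst;
    try discriminate; f_equal; auto using tcode_inj.
Qed.

(** Numbers that code nothing yield an unspecified formula. This is harmless, since [stage] tests
    each formula for consistency before accepting it. *)
Definition fdecode (n : nat) : form :=
  epsilon (inhabits (Eq Zero Zero)) (fun A => fcode A = n).

Lemma fdecode_fcode (A : form) : fdecode (fcode A) = A.
Proof.
  apply fcode_inj; unfold fdecode.
  exact (epsilon_spec (inhabits (Eq Zero Zero)) (fun B => fcode B = fcode A)
           (ex_intro _ A eq_refl)).
Qed.

Definition fresh (l : list form) : nat :=
  epsilon (inhabits 0) (fun m => forall A, In A l -> form_below m A).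

Lemma fresh_spec (l : list form) (A : form) : In A l -> form_below (fresh l) A.
Proof.
  revert A; apply (epsilon_spec (inhabits 0) (fun m => forall A, In A l -> form_below m A)).
  induction l as [|A l [m Hm]].
  - exists 0; intros ? [].
  - destruct (form_bounded A) as [k Hk]; exists (Nat.max k m).
    intros B [<-|HB].
    + apply form_below_mono with k; [lia | assumption].
    + apply form_below_mono with m; [lia | auto].
Qed.

Definition witnesses (l : list form) (A : form) : list form :=
  match A with Ex B => [inst B (Var (fresh (A :: l)))] | _ => [] end.

(** * Maximal consistent theories with witnesses *)

Section Henkin.
Variable Th : theory.
(** A theory of sentences leaves all variables free for use as witnesses, so freshness concerns only
    the finite list of formulas added so far. *)
Hypothesis Th_closed : forall B, Th B -> form_below 0 B.
Variable A0 : form.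
Hypothesis A0_unprovable : ~ proves Th A0.

Definition with_list (l : list form) : theory := fun B => Th B \/ In B l.

Fixpoint stage (n : nat) : list form :=
  match n with
  | 0 => [Neg A0]
  | S n =>
      let A := fdecode n in
      if excluded_middle_informative (consistent (extend (with_list (stage n)) A))
      then witnesses (stage n) A ++ A :: stage n
      else stage n
  end.

Lemma consistent_sub (U V : theory) : (forall B, U B -> V B) -> consistent V -> consistent U.
Proof.
  intros HUV HV (B & (G & HG & HB) & (G' & HG' & HB')); apply HV.
  exists B; split; [exists G | exists G']; auto.
Qed.

Lemma stage_consistent (n : nat) : consistent (with_list (stage n)).
Proof.
  induction n as [|n IH]; simpl.
  - intros (B & HB & HnB); apply A0_unprovable.
    assert (Hsub : forall C, proves (with_list [Neg A0]) C -> proves (extend Th (Neg A0)) C).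
    { intro C; apply proves_cut; intros D HD; apply proves_ass.
      destruct HD as [HD|[<-|[]]]; [now left | now right]. }
    apply Hsub, proves_extend in HB as (G & HG & HB).
    apply Hsub, proves_extend in HnB as (G' & HG' & HnB).
    exists (G ++ G'); split.
    + intros C HC; apply in_app_or in HC as []; auto.
    + apply d_raa with B; (eapply derives_weaken; [eassumption|]);
        (intros C [<-|HC]; [now left | right; apply in_or_app; auto]).
  - destruct (excluded_middle_informative _) as [H|H]; [|assumption].
    assert (H1 : consistent (with_list (fdecode n :: stage n))).
    { revert H; apply consistent_sub; intros B [HB|[HB|HB]].
      - left; now left.
      - now right.
      - left; now right. }
    destruct (fdecode n) as [| | | | |B|] eqn:E; try exact H1; simpl.
    assert (H2 : consistent (extend (with_list (Ex B :: stage n))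
                               (inst B (Var (fresh (Ex B :: stage n)))))).
    { apply extend_henkin_consistent.
      - intros C [HC|HC]; [|now apply fresh_spec].
        eapply form_below_mono; [|apply Th_closed, HC]; lia.
      - apply fresh_spec; now left.
      - right; now left.
      - assumption. }
    revert H2; apply consistent_sub; intros C [HC|[HC|HC]].
    + left; now left.
    + right; now symmetry.
    + left; now right.
Qed.

Definition omega : theory := fun A => exists n, with_list (stage n) A.

Lemma stage_mono (n m : nat) (A : form) : n <= m -> In A (stage n) -> In A (stage m).
Proof.
  induction 1 as [|m _ IH]; [trivial|]; intro HA; simpl.
  destruct (excluded_middle_informative _); auto.
  apply in_or_app; right; right; auto.
Qed.

Lemma omega_proves_stage (A : form) :
  proves omega A -> exists n, proves (with_list (stage n)) A.
Proof.
  intros (G & HG & HA).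
  assert (Hn : exists n, forall B, In B G -> with_list (stage n) B).
  { clear HA; induction G as [|B G IH]; [exists 0; intros ? []|].
    destruct IH as [n Hn]; [intros; apply HG; now right|].
    destruct (HG B) as [m Hm]; [now left|].
    exists (Nat.max n m); intros C [<-|HC].
    - destruct Hm as [Hm|Hm]; [now left | right; eapply stage_mono; [|eassumption]; lia].
    - destruct (Hn C HC) as [H|H]; [now left | right; eapply stage_mono; [|eassumption]; lia]. }
  destruct Hn as [n Hn]; exists n, G; auto.
Qed.

Lemma omega_consistent : consistent omega.
Proof.
  intros (B & HB & HnB).
  apply omega_proves_stage in HB as [n HB], HnB as [m HnB].
  apply (stage_consistent (Nat.max n m)); exists B; split.
  - revert HB; apply proves_cut; intros C [HC|HC]; apply proves_ass; [now left|right].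
    eapply stage_mono; [|eassumption]; lia.
  - revert HnB; apply proves_cut; intros C [HC|HC]; apply proves_ass; [now left|right].
    eapply stage_mono; [|eassumption]; lia.
Qed.

(** [A] is decided at stage [fcode A]. Consistency with the limit implies consistency with that
    stage, so [A] is accepted there together with its witness. Deductive closure, maximality and the
    witness property all come from this. *)
Lemma omega_step (A : form) : consistent (extend omega A) ->
  omega A /\ forall B, A = Ex B -> exists t, omega (inst B t).
Proof.
  intro H.
  assert (Hc : consistent (extend (with_list (stage (fcode A))) A)).
  { revert H; apply consistent_sub; intros B [HB|HB]; [left; now exists (fcode A)|now right]. }
  assert (Hin : incl (witnesses (stage (fcode A)) A ++ A :: stage (fcode A))
                  (stage (S (fcode A)))).
  { simpl; rewrite fdecode_fcode.
    destruct (excluded_middle_informative _) as [_|N]; [apply incl_refl | contradiction]. }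
  split.
  - exists (S (fcode A)); right; apply Hin, in_or_app; right; now left.
  - intros B ->; eexists; exists (S (fcode (Ex B))); right; apply Hin; now left.
Qed.

Lemma omega_closed (A : form) : proves omega A -> omega A.
Proof.
  intro HA; apply omega_step; intro Hinc; apply omega_consistent.
  exists A; split; [assumption|]; apply inconsistent_proves_neg; intro H; now apply H.
Qed.

Lemma omega_neg (A : form) : omega (Neg A) <-> ~ omega A.
Proof.
  split.
  - intros Hn HA; apply omega_consistent; exists A; split; now apply proves_ass.
  - intro H; apply omega_closed, inconsistent_proves_neg; intro Hc.
    now apply H, omega_step.
Qed.

Lemma omega_from1 (A B : form) : derives [A] B -> omega A -> omega B.
Proof. intros HD HA; apply omega_closed, (proves_from1 _ A B HD), proves_ass, HA. Qed.

Lemma omega_from2 (A B C : form) : derives [A; B] C -> omega A -> omega B -> omega C.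
Proof.
  intros HD HA HB; apply omega_closed, (proves_from2 _ A B C HD); now apply proves_ass.
Qed.

Lemma omega_valid (A : form) : derives [] A -> omega A.
Proof. intro HD; apply omega_closed; exists []; split; [intros ? []|assumption]. Qed.

Lemma omega_and (A B : form) : omega (And A B) <-> omega A /\ omega B.
Proof.
  split; [intro H; split; revert H; apply omega_from1|].
  3: intros [HA HB]; revert HA HB; apply omega_from2.
  - apply d_andE1 with B, d_ass; now left.
  - apply d_andE2 with A, d_ass; now left.
  - apply d_andI; apply d_ass; simpl; auto.
Qed.

Lemma omega_or (A B : form) : omega (Or A B) <-> omega A \/ omega B.
Proof.
  split.
  - intro H; destruct (classic (omega A)) as [HA|HA]; [now left|right].
    apply omega_neg in HA; revert H HA; apply omega_from2.
    apply d_orE with A B; try (apply d_ass; simpl; auto; fail).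
    apply derives_explode with A; apply d_ass; simpl; auto.
  - intros [H|H]; revert H; apply omega_from1.
    + apply d_orI1, d_ass; now left.
    + apply d_orI2, d_ass; now left.
Qed.

Lemma omega_ex (A : form) : omega (Ex A) <-> exists t, omega (inst A t).
Proof.
  split.
  - intro H; apply (omega_step (Ex A)); [|reflexivity].
    apply consistent_sub with omega; [|apply omega_consistent].
    intros B [HB| ->]; assumption.
  - intros [t H]; revert H; apply omega_from1.
    apply d_exI with t, d_ass; now left.
Qed.

Lemma omega_all (A : form) : omega (All A) <-> forall t, omega (inst A t).
Proof.
  split.
  - intros H t; revert H; apply omega_from1, d_allE, d_ass; now left.
  - intro H; apply NNPP; intro Hn; apply omega_neg in Hn.
    assert (He : omega (Ex (Neg A))).
    (* Quantifier duality inside the calculus: if [Ex (Neg A)] fails, then [A] holds of the generic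
       [Var 0], whence [All A]. *)
    { revert Hn; apply omega_from1.
      apply d_raa with (All A); [|apply d_ass; simpl; auto].
      apply d_allI; simpl.
      apply d_raa with (shift (Ex (Neg A))); [|apply d_ass; simpl; auto].
      unfold shift; simpl; apply d_exI with (Var 0).
      change (inst (Neg ?B) ?t) with (Neg (inst B t)); rewrite inst_fsubst_up.
      replace (fsubst (scons (Var 0) (fun n => Var (S n))) A) with A; [apply d_ass; now left|].
      rewrite <- (fsubst_var A) at 1; f_equal; extensionality n; now destruct n. }
    apply omega_ex in He as [t Ht]; cbn in Ht; apply omega_neg in Ht; apply Ht, H.
Qed.

(** * The term model *)

Definition teq (s t : term) : Prop := omega (Eq s t).

Lemma omega_rewrite (A : form) (s t : term) : teq s t -> omega (inst A s) -> omega (inst A t).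
Proof.
  apply omega_from2, d_eqE with s; apply d_ass; simpl; auto.
Qed.

Lemma teq_refl (t : term) : teq t t.
Proof. apply omega_valid, d_eqI. Qed.

Lemma tsubst_scons_shift (s t : term) :
  tsubst (scons s Var) (tsubst (fun n => Var (S n)) t) = t.
Proof. rewrite tsubst_comp; apply tsubst_var. Qed.

Lemma teq_sym (s t : term) : teq s t -> teq t s.
Proof.
  intro H.
  (* Leibniz's law for the formula x = s, where [s] is shifted past the variable x. *)
  assert (K := omega_rewrite (Eq (Var 0) (tsubst (fun n => Var (S n)) s)) s t H).
  cbn in K; rewrite !tsubst_scons_shift in K; apply K, teq_refl.
Qed.

Lemma teq_trans (s t u : term) : teq s t -> teq t u -> teq s u.
Proof.
  intros H1 H2.
  assert (K := omega_rewrite (Eq (tsubst (fun n => Var (S n)) s) (Var 0)) t u H2).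
  cbn in K; rewrite !tsubst_scons_shift in K; exact (K H1).
Qed.

Definition rep (t : term) : term := epsilon (inhabits Zero) (teq t).

Lemma rep_teq (t : term) : teq t (rep t).
Proof.
  apply (epsilon_spec (inhabits Zero) (teq t)); exists t; apply teq_refl.
Qed.

(** Terms in the same class define equal predicates by extensionality, and [epsilon] makes the same
    choice for equal predicates. *)
Lemma rep_eq (s t : term) : teq s t -> rep s = rep t.
Proof.
  intro H; unfold rep; f_equal; extensionality u; apply propositional_extensionality.
  split; intro K; [eapply teq_trans; [apply teq_sym|]|eapply teq_trans]; eassumption.
Qed.

Lemma rep_idem (t : term) : rep (rep t) = rep t.
Proof. symmetry; apply rep_eq, rep_teq. Qed.


(* Equality is made true by keeping one representative per class of provably equal terms. *)
Definition term_model : structure := {|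
  carrier := {t : term | rep t = t};
  izero := exist _ (rep Zero) (rep_idem _);
  isucc x := exist _ (rep (Succ (proj1_sig x))) (rep_idem _);
  iadd x y := exist _ (rep (Add (proj1_sig x) (proj1_sig y))) (rep_idem _);
  imul x y := exist _ (rep (Mul (proj1_sig x) (proj1_sig y))) (rep_idem _);
  itr x := omega (Tr (proj1_sig x))
|}.

Lemma term_model_eq (x y : term_model) : proj1_sig x = proj1_sig y -> x = y.
Proof.
  destruct x as [s Hs], y as [t Ht]; simpl; intros ->; f_equal; apply proof_irrelevance.
Qed.

Definition names (rho : nat -> term_model) (n : nat) : term := proj1_sig (rho n).

(** [u] is the context that [f] fills, with its hole at index 0. Congruence of each function symbol
    is Leibniz's law for one such context. *)
Lemma teq_rewrite (f : term -> term) (u : term) (s t : term) :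
  (forall x, tsubst (scons x Var) u = f x) -> teq s t -> teq (f s) (f t).
Proof.
  intros Hf H.
  assert (K := omega_rewrite (Eq (tsubst (fun n => Var (S n)) (f s)) u) s t H).
  cbn in K; rewrite !tsubst_scons_shift, !Hf in K; apply K, teq_refl.
Qed.

Lemma teq_succ (s t : term) : teq s t -> teq (Succ s) (Succ t).
Proof. apply (teq_rewrite Succ (Succ (Var 0))); reflexivity. Qed.

Lemma teq_add (s s' t t' : term) : teq s s' -> teq t t' -> teq (Add s t) (Add s' t').
Proof.
  intros H H'; apply teq_trans with (Add s' t).
  - revert H; apply (teq_rewrite (fun x => Add x t) (Add (Var 0) (tsubst (fun n => Var (S n)) t))).
    intro x; simpl; now rewrite tsubst_scons_shift.
  - revert H'; apply (teq_rewrite (Add s') (Add (tsubst (fun n => Var (S n)) s') (Var 0))).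
    intro x; simpl; now rewrite tsubst_scons_shift.
Qed.

Lemma teq_mul (s s' t t' : term) : teq s s' -> teq t t' -> teq (Mul s t) (Mul s' t').
Proof.
  intros H H'; apply teq_trans with (Mul s' t).
  - revert H; apply (teq_rewrite (fun x => Mul x t) (Mul (Var 0) (tsubst (fun n => Var (S n)) t))).
    intro x; simpl; now rewrite tsubst_scons_shift.
  - revert H'; apply (teq_rewrite (Mul s') (Mul (tsubst (fun n => Var (S n)) s') (Var 0))).
    intro x; simpl; now rewrite tsubst_scons_shift.
Qed.

Lemma eval_term_model (rho : nat -> term_model) (t : term) :
  proj1_sig (eval rho t) = rep (tsubst (names rho) t).
Proof.
  assert (Hrep : forall x, teq (rep x) x) by (intro; apply teq_sym, rep_teq).
  induction t; simpl.
  - unfold names; symmetry; exact (proj2_sig (rho n)).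
  - reflexivity.
  - rewrite IHt; now apply rep_eq, teq_succ.
  - rewrite IHt1, IHt2; now apply rep_eq, teq_add.
  - rewrite IHt1, IHt2; now apply rep_eq, teq_mul.
Qed.

(** The truth lemma. Quantifiers of the model range over representatives, those of [omega] over all
    terms; [omega_rewrite] passes between a term and its representative. *)
Lemma sat_term_model (A : form) : forall rho : nat -> term_model,
  sat rho A <-> omega (fsubst (names rho) A).
Proof.
  assert (Hcons : forall (rho : nat -> term_model) a,
    names (icons a rho) = scons (proj1_sig a) (names rho)).
  { intros rho a; extensionality n; now destruct n. }
  assert (Hrep : forall (t : term), exists a : term_model, proj1_sig a = rep t).
  { intro t; now exists (exist (fun u => rep u = u) (rep t) (rep_idem t)). }
  induction A; intro rho; simpl.
  - split.
    + intro H; apply (f_equal (@proj1_sig _ _)) in H; rewrite !eval_term_model in H.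
      apply teq_trans with (rep (tsubst (names rho) s)); [apply rep_teq|].
      rewrite H; apply teq_sym, rep_teq.
    + intro H; apply term_model_eq; rewrite !eval_term_model; now apply rep_eq.
  - rewrite eval_term_model; split; apply (omega_rewrite (Tr (Var 0)));
      [apply teq_sym|]; apply rep_teq.
  - now rewrite omega_neg, IHA.
  - now rewrite omega_or, IHA1, IHA2.
  - now rewrite omega_and, IHA1, IHA2.
  - rewrite omega_ex; split.
    + intros [a Ha]; exists (proj1_sig a).
      rewrite inst_fsubst_up, <- Hcons; now apply IHA.
    + intros [t Ht]; destruct (Hrep t) as [a Ha]; exists a.
      apply IHA; rewrite Hcons, Ha, <- inst_fsubst_up.
      revert Ht; apply omega_rewrite, rep_teq.
  - rewrite omega_all; split.
    + intros H t; destruct (Hrep t) as [a Ha].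
      apply omega_rewrite with (rep t); [apply teq_sym, rep_teq|].
      rewrite inst_fsubst_up, <- Ha, <- Hcons; now apply IHA.
    + intros H a; apply IHA; rewrite Hcons, <- inst_fsubst_up; apply H.
Qed.

Lemma term_model_models : models term_model Th.
Proof.
  intros B HB rho; apply sat_term_model.
  rewrite fsubst_closed; [exists 0; now left | auto].
Qed.

Lemma term_model_refutes (rho : nat -> term_model) : form_below 0 A0 -> ~ sat rho A0.
Proof.
  intros Hcl H; apply sat_term_model in H; rewrite fsubst_closed in H by assumption.
  revert H; apply omega_neg; exists 0; right; now left.
Qed.

End Henkin.

Theorem completeness (Th : theory) (A : form) :
  (forall B, Th B -> form_below 0 B) -> form_below 0 A ->
  (forall M : structure, models M Th -> forall rho : nat -> M, sat rho A) ->
  proves Th A.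
Proof.
  intros HTh HA Hval; apply NNPP; intro Hn.
  apply (term_model_refutes Th HTh A Hn (fun _ => izero) HA).
  apply Hval, term_model_models; assumption.
Qed.

(** * Arithmetically definable predicates with parameters *)

Lemma arithmetical_fsubst (A : form) : forall sigma,
  arithmetical A -> arithmetical (fsubst sigma A).
Proof. induction A; simpl; intuition. Qed.

Section Definability.
Context {M : structure}.

(* A variable of a defining formula denotes either a coordinate of the
   environment or a parameter from the structure. *)
Definition lookup (rho : nat -> M) (s : nat + M) : M :=
  match s with inl k => rho k | inr c => c end.

(** This lets the induction scheme be applied to predicates stated in Rocq, with elements of the
    model as parameters, without writing their formulas by hand. *)
Definition definable (P : (nat -> M) -> Prop) : Prop :=
  exists (A : form) (f : nat -> nat + M), arithmetical A /\
    forall rho, P rho <-> sat (fun n => lookup rho (f n)) A.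

Lemma definable_rename (r : nat -> nat) (P : (nat -> M) -> Prop) :
  definable P -> definable (fun rho => P (fun n => rho (r n))).
Proof.
  intros (A & f & HA & H).
  exists A, (fun n => match f n with inl k => inl (r k) | inr c => inr c end).
  split; [assumption|]; intro rho; rewrite H.
  replace (fun n => lookup (fun n => rho (r n)) (f n))
    with (fun n => lookup rho (match f n with inl k => inl (r k) | inr c => inr c end));
    [reflexivity|].
  extensionality n; now destruct (f n).
Qed.

(** The two predicates come with unrelated assignments of variables. Even indices carry one and odd
    indices the other, so that both formulas can be combined. *)
Lemma definable_pair (P Q : (nat -> M) -> Prop) : definable P -> definable Q ->
  exists A B f, arithmetical A /\ arithmetical B /\ forall rho,
    (P rho <-> sat (fun n => lookup rho (f n)) A) /\
    (Q rho <-> sat (fun n => lookup rho (f n)) B).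
Proof.
  intros (A & f & HA & HP) (B & g & HB & HQ).
  exists (fsubst (fun n => Var (2 * n)) A), (fsubst (fun n => Var (S (2 * n))) B),
    (fun n => if Nat.even n then f (Nat.div2 n) else g (Nat.div2 n)).
  split; [now apply arithmetical_fsubst|]; split; [now apply arithmetical_fsubst|].
  intro rho; rewrite !sat_fsubst, HP, HQ; cbn [eval].
  split; match goal with |- sat ?r _ <-> sat ?r' _ => replace r' with r; [reflexivity|] end;
    extensionality n.
  - now rewrite Nat.even_even, Nat.div2_double.
  - now rewrite Nat.div2_succ_double, <- Nat.add_1_r, Nat.even_odd.
Qed.

Lemma definable_not (P : (nat -> M) -> Prop) :
  definable P -> definable (fun rho => ~ P rho).
Proof.
  intros (A & f & HA & H); exists (Neg A), f; split; [assumption|].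
  intro rho; simpl; now rewrite H.
Qed.

Lemma definable_and (P Q : (nat -> M) -> Prop) :
  definable P -> definable Q -> definable (fun rho => P rho /\ Q rho).
Proof.
  intros HP HQ; destruct (definable_pair P Q HP HQ) as (A & B & f & HA & HB & H).
  exists (And A B), f; split; [now split|].
  intro rho; destruct (H rho) as [H1 H2]; simpl; now rewrite H1, H2.
Qed.

Lemma definable_or (P Q : (nat -> M) -> Prop) :
  definable P -> definable Q -> definable (fun rho => P rho \/ Q rho).
Proof.
  intros HP HQ; destruct (definable_pair P Q HP HQ) as (A & B & f & HA & HB & H).
  exists (Or A B), f; split; [now split|].
  intro rho; destruct (H rho) as [H1 H2]; simpl; now rewrite H1, H2.
Qed.

Lemma definable_ext (P Q : (nat -> M) -> Prop) :
  (forall rho, P rho <-> Q rho) -> definable P -> definable Q.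
Proof.
  intros HPQ (A & f & HA & H); exists A, f; split; [assumption|].
  intro rho; now rewrite <- HPQ.
Qed.

Lemma definable_imp (P Q : (nat -> M) -> Prop) :
  definable P -> definable Q -> definable (fun rho => P rho -> Q rho).
Proof.
  intros HP HQ; apply definable_ext with (fun rho => ~ P rho \/ Q rho).
  - intro rho; split; [tauto|]; intro H; destruct (classic (P rho)); tauto.
  - apply definable_or; [now apply definable_not | assumption].
Qed.

Lemma definable_ex (Q : M -> (nat -> M) -> Prop) :
  definable (fun rho => Q (rho 0) (fun n => rho (S n))) ->
  definable (fun rho => exists b, Q b rho).
Proof.
  intros (A & f & HA & H).
  (* Several variables of [A] may denote coordinate 0; all of them are merged into the one bound
     index. *)
  exists (Ex (fsubst (fun n => match f n with inl 0 => Var 0 | _ => Var (S n) end) A)),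
    (fun n => match f n with inl (S k) => inl k | s => s end).
  split; [now apply arithmetical_fsubst|]; intro rho; simpl.
  assert (Hb : forall b, Q b rho <-> sat (icons b (fun n => lookup rho
      (match f n with inl (S k) => inl k | s => s end)))
      (fsubst (fun n => match f n with inl 0 => Var 0 | _ => Var (S n) end) A)).
  { intro b; rewrite sat_fsubst; specialize (H (icons b rho)); simpl in H.
    change (fun n => rho n) with rho in H; rewrite H.
    match goal with |- sat ?r _ <-> sat ?r' _ => replace r' with r; [reflexivity|] end.
    extensionality n; simpl; destruct (f n) as [[|k]|c] eqn:E; simpl; now rewrite ?E. }
  split; intros [b Hq]; exists b; now apply Hb.
Qed.

Lemma definable_all (Q : M -> (nat -> M) -> Prop) :
  definable (fun rho => Q (rho 0) (fun n => rho (S n))) ->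
  definable (fun rho => forall b, Q b rho).
Proof.
  intro H; apply definable_ext with (fun rho => ~ exists b, ~ Q b rho).
  - intro rho; split.
    + intros Hn b; apply NNPP; intro K; apply Hn; now exists b.
    + intros Ha [b Hb]; auto.
  - now apply definable_not, definable_ex, definable_not.
Qed.

(** Functions are treated through their graphs: coordinate 0 holds the value and the arguments move
    up by one. Composition then quantifies over the intermediate values. *)
Definition definable_fun (F : (nat -> M) -> M) : Prop :=
  definable (fun rho => F (fun n => rho (S n)) = rho 0).

Lemma definable_atom (s t : term) (f : nat -> nat + M) :
  definable (fun rho => eval (fun n => lookup rho (f n)) s = eval (fun n => lookup rho (f n)) t).
Proof. exists (Eq s t), f; split; [exact I | reflexivity]. Qed.

Lemma definable_fun_var (i : nat) : definable_fun (fun rho => rho i).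
Proof. exact (definable_atom (Var (S i)) (Var 0) inl). Qed.

Lemma definable_fun_const (c : M) : definable_fun (fun _ => c).
Proof.
  exact (definable_atom (Var 1) (Var 0) (fun n => match n with 0 => inl 0 | _ => inr c end)).
Qed.

Lemma definable_fun_comp1 (h : M -> M) (F : (nat -> M) -> M) :
  definable (fun rho => h (rho 1) = rho 0) ->
  definable_fun F -> definable_fun (fun rho => h (F rho)).
Proof.
  intros Hh HF.
  apply definable_ext with
    (fun rho => exists x, F (fun n => rho (S n)) = x /\ h x = rho 0).
  - intro rho; split; [now intros (x & <- & H) | intro H; eexists; eauto].
  - apply definable_ex, definable_and.
    + exact (definable_rename (fun n => match n with 0 => 0 | S n => S (S n) end) _ HF).
    + exact (definable_rename (fun n => match n with 0 => 1 | _ => 0 end) _ Hh).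
Qed.

Lemma definable_fun_comp2 (h : M -> M -> M) (F G : (nat -> M) -> M) :
  definable (fun rho => h (rho 1) (rho 2) = rho 0) ->
  definable_fun F -> definable_fun G -> definable_fun (fun rho => h (F rho) (G rho)).
Proof.
  intros Hh HF HG.
  apply definable_ext with (fun rho => exists x y,
    F (fun n => rho (S n)) = x /\ G (fun n => rho (S n)) = y /\ h x y = rho 0).
  - intro rho; split; [now intros (x & y & <- & <- & H) | intro H; do 2 eexists; eauto].
  - apply definable_ex, definable_ex, definable_and; [|apply definable_and].
    + exact (definable_rename (fun n => match n with 0 => 1 | S n => S (S (S n)) end) _ HF).
    + exact (definable_rename (fun n => match n with 0 => 0 | S n => S (S (S n)) end) _ HG).
    + exact (definable_rename (fun n => match n with 0 => 2 | 1 => 1 | _ => 0 end) _ Hh).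
Qed.

Lemma definable_fun_succ (F : (nat -> M) -> M) :
  definable_fun F -> definable_fun (fun rho => isucc (F rho)).
Proof. apply definable_fun_comp1; exact (definable_atom (Succ (Var 1)) (Var 0) inl). Qed.

Lemma definable_fun_add (F G : (nat -> M) -> M) :
  definable_fun F -> definable_fun G -> definable_fun (fun rho => iadd (F rho) (G rho)).
Proof. apply definable_fun_comp2; exact (definable_atom (Add (Var 1) (Var 2)) (Var 0) inl). Qed.

Lemma definable_fun_mul (F G : (nat -> M) -> M) :
  definable_fun F -> definable_fun G -> definable_fun (fun rho => imul (F rho) (G rho)).
Proof. apply definable_fun_comp2; exact (definable_atom (Mul (Var 1) (Var 2)) (Var 0) inl). Qed.

Lemma definable_comp2 (R : M -> M -> Prop) (F G : (nat -> M) -> M) :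
  definable (fun rho => R (rho 0) (rho 1)) ->
  definable_fun F -> definable_fun G -> definable (fun rho => R (F rho) (G rho)).
Proof.
  intros HR HF HG.
  apply definable_ext with (fun rho => exists x y, F rho = x /\ G rho = y /\ R x y).
  - intro rho; split; [now intros (x & y & <- & <- & H) | intro H; do 2 eexists; eauto].
  - apply definable_ex, definable_ex, definable_and; [|apply definable_and].
    + exact (definable_rename (fun n => match n with 0 => 1 | S n => S (S n) end) _ HF).
    + exact (definable_rename (fun n => match n with 0 => 0 | S n => S (S n) end) _ HG).
    + exact (definable_rename (fun n => match n with 0 => 1 | _ => 0 end) _ HR).
Qed.

Lemma definable_comp3 (R : M -> M -> M -> Prop) (F G H : (nat -> M) -> M) :
  definable (fun rho => R (rho 0) (rho 1) (rho 2)) ->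
  definable_fun F -> definable_fun G -> definable_fun H ->
  definable (fun rho => R (F rho) (G rho) (H rho)).
Proof.
  intros HR HF HG HH.
  apply definable_ext with
    (fun rho => exists x y z, F rho = x /\ G rho = y /\ H rho = z /\ R x y z).
  - intro rho; split;
      [now intros (x & y & z & <- & <- & <- & K) | intro K; do 3 eexists; eauto].
  - apply definable_ex, definable_ex, definable_ex; repeat apply definable_and.
    + exact (definable_rename (fun n => match n with 0 => 2 | S n => S (S (S n)) end) _ HF).
    + exact (definable_rename (fun n => match n with 0 => 1 | S n => S (S (S n)) end) _ HG).
    + exact (definable_rename (fun n => match n with 0 => 0 | S n => S (S (S n)) end) _ HH).
    + exact (definable_rename (fun n => match n with 0 => 2 | 1 => 1 | _ => 0 end) _ HR).
Qed.

Lemma definable_eq (F G : (nat -> M) -> M) :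
  definable_fun F -> definable_fun G -> definable (fun rho => F rho = G rho).
Proof.
  apply (definable_comp2 eq); exact (definable_atom (Var 0) (Var 1) inl).
Qed.

Lemma sat_iter_all (k : nat) (A : form) :
  (forall rho : nat -> M, sat rho (Nat.iter k All A)) -> forall rho : nat -> M, sat rho A.
Proof.
  induction k as [|k IH]; simpl; [trivial|]; intros H; apply IH; intro rho.
  replace rho with (icons (rho 0) (fun n => rho (S n))); [apply H|].
  extensionality n; now destruct n.
Qed.

Lemma definable_induction (P : M -> Prop) : models M PA ->
  definable (fun rho => P (rho 0)) ->
  P izero -> (forall x, P x -> P (isucc x)) -> forall x, P x.
Proof.
  intros HPA (A & f & HA & H) H0 HS.
  set (B := fsubst (fun n => match f n with inl 0 => Var 0 | _ => Var (S n) end) A).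
  (* [P] looks at coordinate 0 only, so every other coordinate may take the value zero. *)
  set (rho n := match f n with inl _ => izero | inr c => c end).
  assert (HB : forall x, P x <-> sat (icons x rho) B).
  { intro x; unfold B; rewrite sat_fsubst, (H (icons x (fun _ => izero))).
    match goal with |- sat ?r _ <-> sat ?r' _ => replace r' with r; [reflexivity|] end.
    extensionality n; unfold rho; simpl.
    destruct (f n) as [[|k]|c] eqn:E; simpl; now rewrite ?E. }
  (* The axiom is the universal closure of the induction instance. A prefix of [k] quantifiers
     covers all parameters of [B], and [sat_iter_all] strips it at [rho]. *)
  destruct (form_bounded B) as [k Hk].
  assert (HI := sat_iter_all k (induction_for B)
    (HPA _ (PA_induction k B (arithmetical_fsubst A _ HA)
       (form_below_mono B k (S k) (Nat.le_succ_diag_r k) Hk))) rho).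
  assert (Hzero : sat rho (inst B Zero)).
  { unfold inst; rewrite sat_fsubst; apply HB in H0; revert H0.
    match goal with |- sat ?r _ -> sat ?r' _ => replace r' with r; [trivial|] end.
    extensionality n; now destruct n. }
  destruct HI as [HI|HI]; [exfalso; apply HI|intro x; now apply HB].
  split; [exact Hzero|]; intro x; simpl.
  destruct (classic (sat (icons x rho) B)) as [Hx|Hx]; [right|now left].
  apply HB, HS, HB in Hx; rewrite sat_fsubst; revert Hx.
  match goal with |- sat ?r _ -> sat ?r' _ => replace r' with r; [trivial|] end.
  extensionality n; now destruct n.
Qed.

End Definability.

(** Notions such as [ientry] and [ipair] have no rule of their own: unification unfolds them down to
    logical constants and arithmetical operations. Abstract relations are covered by hypotheses on
    their definability. *)
Ltac definable_step :=
  first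
  [ assumption
  | apply definable_fun_var
  | apply definable_fun_const
  | apply definable_fun_succ
  | apply definable_fun_add
  | apply definable_fun_mul
  | apply definable_eq
  | apply definable_ex; cbv beta
  | apply definable_and
  | apply definable_or
  | apply definable_not
  | apply definable_imp
  | apply definable_all; cbv beta
  | eapply definable_comp2; [eassumption| |]
  | eapply definable_comp3; [eassumption| | |] ].

Ltac definability := cbv beta; repeat definable_step.

(** * Coded sequences and syntax in structures *)

(* Each [ifoo] below repeats the definition of the formula [foo] inside a
   structure, so that satisfaction of [foo] unfolds to [ifoo] by conversion. *)
Declare Scope model_scope.
Delimit Scope model_scope with model.
Notation "0" := izero : model_scope.
Notation "x + y" := (iadd x y) : model_scope.
Notation "x * y" := (imul x y) : model_scope.

Definition ilt {M : structure} (x y : M) : Prop := exists z, iadd x (isucc z) = y.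
Notation "x < y" := (ilt x y) : model_scope.

Definition ione {M : structure} : M := isucc izero.
Definition ipair {M : structure} (x y : M) : M :=
  isucc ((x + y) * (x + y) + x)%model.

Definition ibeta {M : structure} (a b i x : M) : Prop :=
  ((exists q, a = q * isucc (isucc i * b) + x) /\ x < isucc (isucc i * b))%model.

Definition ilh {M : structure} (s l : M) : Prop := exists a b, s = ipair l (ipair a b).

Definition ientry {M : structure} (s i x : M) : Prop :=
  exists l a b, s = ipair l (ipair a b) /\ (i < l)%model /\ ibeta a b i x.

Section Syntax.
Local Open Scope model_scope.
Context {M : structure}.
Implicit Types (s t v w x y z l i : M).

Definition iimp (P Q : Prop) : Prop := ~ P \/ Q.
Definition iiff (P Q : Prop) : Prop := iimp P Q /\ iimp Q P.

Definition iearlier s i x : Prop := exists j, j < i /\ ientry s j x.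

Definition ibuilt (step : (M -> Prop) -> M -> Prop) x : Prop :=
  exists s l, ilh s (isucc l) /\ ientry s l x /\
    forall i y, iimp (ientry s i y) (step (iearlier s i) y).

Fixpoint inum (k : nat) : M :=
  match k with 0%nat => 0 | S k => isucc (inum k) end.

Definition icvar i : M := ipair (inum 0) i.
Definition iczero : M := ipair (inum 1) (inum 0).
Definition icsucc t : M := ipair (inum 2) t.
Definition icadd s t : M := ipair (inum 3) (ipair s t).
Definition icmul s t : M := ipair (inum 4) (ipair s t).
Definition iceq s t : M := ipair (inum 5) (ipair s t).
Definition icneg x : M := ipair (inum 6) x.
Definition icor x y : M := ipair (inum 7) (ipair x y).
Definition icand x y : M := ipair (inum 8) (ipair x y).
Definition icex v x : M := ipair (inum 9) (ipair v x).
Definition icall v x : M := ipair (inum 10) (ipair v x).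

Definition iis_var v : Prop := exists i, v = icvar i.

Definition iis_term : M -> Prop := ibuilt (fun prev x =>
  x = iczero \/ iis_var x
  \/ (exists y, prev y /\ x = icsucc y)
  \/ (exists y z, prev y /\ prev z /\ (x = icadd y z \/ x = icmul y z))).

Definition form_step (prev : M -> Prop) x : Prop :=
  (exists s t, iis_term s /\ iis_term t /\ x = iceq s t)
  \/ (exists y, prev y /\ x = icneg y)
  \/ (exists y z, prev y /\ prev z /\ (x = icor y z \/ x = icand y z))
  \/ (exists v y, iis_var v /\ prev y /\ (x = icex v y \/ x = icall v y)).

Definition iis_form : M -> Prop := ibuilt form_step.

Definition ibelow_avoiding v x y : Prop :=
  x = icsucc y \/ x = icneg y
  \/ (exists z, x = icadd y z \/ x = icadd z y \/ x = icmul y z \/ x = icmul z y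
        \/ x = iceq y z \/ x = iceq z y \/ x = icor y z \/ x = icor z y
        \/ x = icand y z \/ x = icand z y)
  \/ (exists w, ~ w = v /\ (x = icex w y \/ x = icall w y)).

Definition ifree_in v x : Prop :=
  exists s l, ilh s (isucc l) /\ ientry s (inum 0) x /\ ientry s l v /\
    forall i y z, iimp (ientry s i y /\ ientry s (isucc i) z) (ibelow_avoiding v y z).

Definition iis_sent x : Prop :=
  iis_form x /\ forall v, iimp (iis_var v) (~ ifree_in v x).

Definition iseq_of (P : M -> Prop) s : Prop :=
  (exists l, ilh s l) /\ forall i x, iimp (ientry s i x) (P x).

Definition idisjunction s d : Prop :=
  exists c u, ilh s (isucc c) /\ ilh u (isucc c)
    /\ (exists x, ientry s (inum 0) x /\ ientry u (inum 0) x)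
    /\ (forall i x y, iimp (ientry u i x /\ ientry s (isucc i) y)
                        (ientry u (isucc i) (icor x y)))
    /\ ientry u c d.

Definition iT_disjunction s : Prop := exists d, idisjunction s d /\ itr d.
Definition iT_entry s i : Prop := exists x, ientry s i x /\ itr x.

End Syntax.

Lemma iimpE (P Q : Prop) : iimp P Q <-> (P -> Q).
Proof. unfold iimp; destruct (classic P); tauto. Qed.

(** * Arithmetic in models of PA *)

Section Models.
Local Open Scope model_scope.
Context {M : structure}.
Hypothesis M_PA : models M PA.
Implicit Types x y z : M.

(** No rule of [definability] mentions [itr], which keeps every induction arithmetical. *)
Ltac induct x :=
  pattern x; apply (definable_induction _ M_PA); [definability | | clear x; intros x IH].

Lemma isucc_nonzero x : isucc x <> 0.
Proof. intro H; apply (M_PA _ PA_succ_nonzero (fun _ => 0) x); now symmetry. Qed.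

Lemma isucc_inj x y : isucc x = isucc y -> x = y.
Proof.
  intro H; destruct (M_PA _ PA_succ_inj (fun _ => 0) x y) as [N|E]; [contradiction N|]; assumption.
Qed.

Lemma iadd_0_r x : x + 0 = x.
Proof. exact (M_PA _ PA_add_zero (fun _ => 0) x). Qed.

Lemma iadd_succ_r x y : x + isucc y = isucc (x + y).
Proof. exact (M_PA _ PA_add_succ (fun _ => 0) x y). Qed.

Lemma imul_0_r x : x * 0 = 0.
Proof. exact (M_PA _ PA_mul_zero (fun _ => 0) x). Qed.

Lemma imul_succ_r x y : x * isucc y = x * y + x.
Proof. exact (M_PA _ PA_mul_succ (fun _ => 0) x y). Qed.

Lemma iadd_0_l x : 0 + x = x.
Proof. induct x; [apply iadd_0_r|]; now rewrite iadd_succ_r, IH. Qed.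

Lemma iadd_succ_l x y : isucc x + y = isucc (x + y).
Proof. induct y; [now rewrite !iadd_0_r|]; now rewrite !iadd_succ_r, IH. Qed.

Lemma iadd_comm x y : x + y = y + x.
Proof.
  induct y; [now rewrite iadd_0_r, iadd_0_l|]; now rewrite iadd_succ_r, iadd_succ_l, IH.
Qed.

Lemma iadd_assoc x y z : x + (y + z) = (x + y) + z.
Proof. induct z; [now rewrite !iadd_0_r|]; now rewrite !iadd_succ_r, IH. Qed.

Lemma imul_0_l x : 0 * x = 0.
Proof. induct x; [apply imul_0_r|]; now rewrite imul_succ_r, IH, iadd_0_r. Qed.

Lemma imul_succ_l x y : isucc x * y = x * y + y.
Proof.
  induct y; [now rewrite !imul_0_r, iadd_0_r|].
  rewrite !imul_succ_r, IH, !iadd_succ_r, <- !iadd_assoc; do 2 f_equal; apply iadd_comm.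
Qed.

Lemma imul_comm x y : x * y = y * x.
Proof.
  induct y; [now rewrite imul_0_r, imul_0_l|]; now rewrite imul_succ_r, imul_succ_l, IH.
Qed.

Lemma imul_add_distr_r x y z : (x + y) * z = x * z + y * z.
Proof.
  induct z; [now rewrite !imul_0_r, iadd_0_r|]; rewrite !imul_succ_r, IH.
  rewrite <- !iadd_assoc; f_equal; rewrite !iadd_assoc; f_equal; apply iadd_comm.
Qed.

Lemma imul_assoc x y z : x * (y * z) = (x * y) * z.
Proof.
  induct z; [now rewrite !imul_0_r|].
  rewrite !imul_succ_r, <- IH, (imul_comm x (y * z + y)), imul_add_distr_r.
  f_equal; apply imul_comm.
Qed.

Lemma isucc_add_one x : isucc x = x + ione.
Proof. unfold ione; now rewrite iadd_succ_r, iadd_0_r. Qed.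

Lemma model_semiring : semi_ring_theory (@izero M) ione iadd imul eq.
Proof.
  constructor; intros.
  - apply iadd_0_l.
  - apply iadd_comm.
  - apply iadd_assoc.
  - unfold ione; now rewrite imul_succ_l, imul_0_l, iadd_0_l.
  - apply imul_0_l.
  - apply imul_comm.
  - apply imul_assoc.
  - apply imul_add_distr_r.
Qed.

Add Ring model_ring : model_semiring (preprocess [rewrite ?isucc_add_one]).

(** * Cancellation and the order *)

Lemma zero_or_isucc x : x = 0 \/ exists y, x = isucc y.
Proof. induct x; [now left|]; right; now exists x. Qed.

Lemma iadd_cancel_l x y z : x + y = x + z -> y = z.
Proof.
  induct x.
  - rewrite !iadd_0_l; trivial.
  - rewrite !iadd_succ_l; intro H; now apply IH, isucc_inj.
Qed.

Lemma iadd_succ_neq x y : x <> x + isucc y.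
Proof.
  intro H; apply (isucc_nonzero y), (iadd_cancel_l x); rewrite iadd_0_r; now symmetry.
Qed.

Lemma ilt_irrefl x : ~ x < x.
Proof. intros [z H]; now apply (iadd_succ_neq x z). Qed.

Lemma ilt_trans x y z : x < y -> y < z -> x < z.
Proof. intros [u <-] [v <-]; exists (u + isucc v); ring. Qed.

Lemma not_ilt_0 x : ~ x < 0.
Proof. intros [z H]; rewrite iadd_succ_r in H; now apply isucc_nonzero in H. Qed.

Lemma ilt_0_succ x : 0 < isucc x.
Proof. exists x; ring. Qed.

Lemma ilt_succ_r x y : x < isucc y <-> x < y \/ x = y.
Proof.
  split.
  - intros [z H]; rewrite iadd_succ_r in H; apply isucc_inj in H.
    destruct (zero_or_isucc z) as [->|[w ->]]; [right|left; now exists w].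
    now rewrite iadd_0_r in H.
  - intros [[z <-]|<-]; [exists (isucc z) | exists 0]; ring.
Qed.

Lemma ilt_succ_diag x : x < isucc x.
Proof. apply ilt_succ_r; now right. Qed.

Lemma ilt_succ_succ x y : isucc x < isucc y <-> x < y.
Proof.
  split; intros [z H]; exists z.
  - apply isucc_inj; rewrite <- H; ring.
  - rewrite <- H; ring.
Qed.

Lemma ilt_total x y : x < y \/ x = y \/ y < x.
Proof.
  induct y.
  - destruct (zero_or_isucc x) as [->|[z ->]]; [right; now left|].
    right; right; apply ilt_0_succ.
  - destruct IH as [H|[->|H]].
    + left; apply ilt_succ_r; now left.
    + left; apply ilt_succ_diag.
    + destruct H as [z <-]; destruct (zero_or_isucc z) as [->|[w ->]].
      * right; left; ring.
      * right; right; exists w; ring.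
Qed.

(** * Pairing, division with remainder and entries of sequences *)

Lemma ipair_inj x y x' y' : ipair x y = ipair x' y' -> x = x' /\ y = y'.
Proof.
  assert (Hlt : forall x y x' y', x + y < x' + y' -> ipair x y <> ipair x' y').
  { clear -M_PA; intros x y x' y' [z Hz] H; unfold ipair in H; apply isucc_inj in H.
    rewrite <- Hz in H.
    (* With s = x + y and the larger sum s + z + 1, the codes differ by 2s(z + 1) + (z + 1)^2 - x +
       x', which is positive because x is at most s. The witness is this difference minus one. *)
    apply (iadd_succ_neq ((x + y) * (x + y) + x)
      (x + y + y + (x + y) * z + (x + y) * z + z + z + z * z + x')).
    rewrite H at 1; ring. }
  intro H; destruct (ilt_total (x + y) (x' + y')) as [K|[K|K]].
  - destruct (Hlt _ _ _ _ K); congruence.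
  - unfold ipair in H; apply isucc_inj in H; rewrite K in H.
    apply iadd_cancel_l in H; subst x'; split; [reflexivity|].
    now apply iadd_cancel_l in K.
  - destruct (Hlt _ _ _ _ K); congruence.
Qed.

Lemma division x m : exists q r, x = q * isucc m + r /\ r < isucc m.
Proof.
  induct x.
  - exists 0, 0; split; [ring | apply ilt_0_succ].
  - destruct IH as (q & r & -> & [z Hz]).
    destruct (zero_or_isucc z) as [->|[w ->]].
    + exists (isucc q), 0; split; [|apply ilt_0_succ]; rewrite <- Hz; ring.
    + exists q, (isucc r); split; [ring|]; exists w; rewrite <- Hz; ring.
Qed.

Lemma ibeta_total a b i : exists x : M, ibeta a b i x.
Proof.
  destruct (division a (isucc i * b)) as (q & r & H & Hr).
  exists r; split; [now exists q | assumption].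
Qed.

Lemma ibeta_functional (a b i x y : M) : ibeta a b i x -> ibeta a b i y -> x = y.
Proof.
  assert (Hlt : forall q q' m x y : M, q < q' -> q * m + x = q' * m + y -> ~ x < m).
  { clear -M_PA; intros q q' m x y [z <-] H [w Hw].
    replace ((q + isucc z) * m + y) with (q * m + (isucc z * m + y)) in H by ring.
    apply iadd_cancel_l in H.
    apply (iadd_succ_neq x (w + z * m + y)); rewrite H at 1; rewrite <- Hw; ring. }
  intros [[q Hq] Hx] [[q' Hq'] Hy]; rewrite Hq in Hq'.
  destruct (ilt_total q q') as [K|[<-|K]].
  - destruct (Hlt _ _ _ _ _ K Hq'); assumption.
  - now apply iadd_cancel_l in Hq'.
  - symmetry in Hq'; destruct (Hlt _ _ _ _ _ K Hq'); assumption.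
Qed.

Lemma ientry_functional (s i x y : M) : ientry s i x -> ientry s i y -> x = y.
Proof.
  intros (l & a & b & -> & _ & H) (l' & a' & b' & E & _ & H').
  apply ipair_inj in E as [_ E]; apply ipair_inj in E as [<- <-].
  eapply ibeta_functional; eassumption.
Qed.

Lemma ientry_total (s l i : M) : ilh s l -> i < l -> exists x, ientry s i x.
Proof.
  intros (a & b & ->) Hi; destruct (ibeta_total a b i) as [x Hx].
  exists x, l, a, b; auto.
Qed.

Lemma ientry_ilt (s l i x : M) : ilh s l -> ientry s i x -> i < l.
Proof.
  intros (a & b & ->) (l' & a' & b' & E & Hi & _).
  now apply ipair_inj in E as [-> _].
Qed.

(** * Goedel's beta function *)

Definition modulus (b i : M) : M := isucc (isucc i * b).

(** Bezout's identity without subtraction: [x] is a unit modulo [m]. It takes the place of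
    coprimality, so no theory of divisors or primes is developed. *)
Definition invertible (x m : M) : Prop := exists u v, u * x = isucc (v * m).

Lemma modulus_invertible (b i d : M) :
  (exists e, b = isucc d * e) -> invertible (modulus b i) (modulus b (i + isucc d)).
Proof.
  intros [e ->]; unfold invertible, modulus.
  set (D := isucc d); set (b := D * e); set (J := isucc (i + D)).
  set (u := J * J * J * b * e); set (K := isucc (J * b * (J * b))).
  (* Modulo 1 + J * b we have J * b = -1 and the first modulus is - D * b, whose inverse is
     - J * J * e = u because D * e = b.  Adding K times the second modulus to u makes the
     cofactor a sum of natural numbers. *)
  exists (u + K * isucc (J * b)), (u + J * b + K * (isucc i * b)).
  unfold u, K, J, b; ring.
Qed.

Lemma invertible_mul (x y m : M) : invertible x m -> invertible y m -> invertible (x * y) m.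
Proof.
  intros (u & v & H) (u' & v' & H'); exists (u * u'), (v + v' + v * v' * m).
  replace (u * u' * (x * y)) with ((u * x) * (u' * y)) by ring; rewrite H, H'; ring.
Qed.

(** The number built is (c + 1) l!, obtained by induction since factorial is not a function symbol.
    Its size makes every modulus exceed all entries; its divisors make the moduli pairwise
    coprime. *)
Lemma common_multiple (l c : M) :
  exists b, c < b /\ forall d, d < l -> exists e, b = isucc d * e.
Proof.
  induct l.
  - exists (isucc c); split; [apply ilt_succ_diag|]; intros d Hd; now apply not_ilt_0 in Hd.
  - destruct IH as (b & [z Hz] & Hb); exists (b * isucc l); split.
    + exists (z + b * l); rewrite <- Hz; ring.
    + intros d Hd; apply ilt_succ_r in Hd as [Hd| ->].
      * destruct (Hb d Hd) as [e He]; exists (e * isucc l); rewrite He; ring.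
      * exists b; ring.
Qed.

(** [p] is the product of the first [k] moduli. Its two properties are all that the Chinese
    remainder theorem uses: adding multiples of [p] preserves the earlier remainders and can adjust
    a later one at will. *)
Lemma moduli_product (b l k : M) :
  (forall d, d < l -> exists e, b = isucc d * e) ->
  exists p, (forall i, i < k -> exists e, p = modulus b i * e) /\
    forall j, j < l -> ~ j < k -> invertible p (modulus b j).
Proof.
  intro Hb; unfold invertible, modulus; induct k.
  - exists ione; split; [intros i Hi; now apply not_ilt_0 in Hi|].
    intros j _ _; exists ione, 0; ring.
  - destruct IH as (p & Hp & Hinv); exists (p * modulus b k); split.
    + intros i Hi; apply ilt_succ_r in Hi as [Hi| ->].
      * destruct (Hp i Hi) as [e ->]; exists (e * modulus b k); unfold modulus; ring.
      * exists p; unfold modulus; ring.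
    + intros j Hj Hjk; apply invertible_mul.
      * apply Hinv; [assumption|]; intro H; apply Hjk, ilt_succ_r; now left.
      * destruct (ilt_total k j) as [[d <-]|[<-|H]].
        -- apply modulus_invertible, Hb, (ilt_trans _ (k + isucc d)); [|assumption].
           exists k; ring.
        -- exfalso; apply Hjk, ilt_succ_diag.
        -- exfalso; apply Hjk, ilt_succ_r; now left.
Qed.

(** The collection principle. The beta function needs a bound on all entries before its parameter
    [b] can be fixed. *)
Lemma bounded_witnesses (R : M -> M -> Prop) (l : M) :
  definable (fun rho => R (rho 0%nat) (rho 1%nat)) ->
  (forall i, i < l -> exists x, R i x) ->
  exists c, forall i, i < l -> exists x, x < c /\ R i x.
Proof.
  intro HR; induct l.
  - intros _; exists 0; intros i Hi; now apply not_ilt_0 in Hi.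
  - intro H; destruct IH as [c Hc].
    { intros i Hi; apply H, ilt_succ_r; now left. }
    destruct (H l) as [x Hx]; [apply ilt_succ_diag|].
    exists (isucc (c + x)); intros i Hi; apply ilt_succ_r in Hi as [Hi| ->].
    + destruct (Hc i Hi) as (y & [z Hz] & Hy); exists y; split; [|assumption].
      exists (isucc (z + x)); rewrite <- Hz; ring.
    + exists x; split; [exists c; ring | assumption].
Qed.

(* One step of the Chinese remainder theorem. *)
Lemma ibeta_adjust (a b k p x : M) :
  invertible p (modulus b k) -> x < modulus b k ->
  exists t, ibeta (a + p * t) b k x.
Proof.
  intros (u & v & Huv) Hx; set (w := isucc k * b).
  (* Modulo 1 + w one has w = -1, so x + a w stands for x - a, and [u] is the inverse of [p]. *)
  exists (u * (x + a * w)); split; [|assumption].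
  exists (a + v * (x + a * w)); fold w.
  replace (p * (u * (x + a * w))) with (u * p * (x + a * w)) by ring.
  rewrite Huv; unfold modulus; fold w; ring.
Qed.

(** Entries are chosen one at a time inside the induction, where the code of the part already built
    is quantified existentially. Hence [R] may be many-valued. *)
Theorem comprehension (R : M -> M -> Prop) (l : M) :
  definable (fun rho => R (rho 0%nat) (rho 1%nat)) ->
  (forall i, i < l -> exists x, R i x) ->
  exists s, ilh s l /\ forall i x, ientry s i x -> R i x.
Proof.
  intros HR Hex.
  destruct (bounded_witnesses R l HR Hex) as [c Hc].
  destruct (common_multiple l c) as (b & Hcb & Hb).
  (* The bound k <= l keeps the induction within the range where the moduli are known to be
     coprime. *)
  assert (Hcode : forall k, ~ l < k ->
    exists a, forall i, i < k -> exists x, R i x /\ ibeta a b i x).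
  { intro k; induct k.
    - intros _; exists 0; intros i Hi; now apply not_ilt_0 in Hi.
    - intro Hk; destruct IH as [a Ha].
      { intro H; apply Hk, ilt_succ_r; now left. }
      assert (Hkl : k < l).
      { destruct (ilt_total k l) as [H|[<-|H]]; [assumption| |];
          exfalso; apply Hk, ilt_succ_r; auto. }
      destruct (moduli_product b l k Hb) as (p & Hp & Hinv).
      destruct (Hc k Hkl) as (x & Hxc & Hx).
      destruct (ibeta_adjust a b k p x) as [t Ht].
      + apply Hinv; [assumption | apply ilt_irrefl].
      + apply ilt_trans with c; [assumption|]; apply ilt_trans with b; [assumption|].
        exists (k * b); unfold modulus; ring.
      (* Each earlier modulus divides [p], so the earlier entries keep their remainders. *)
      + exists (a + p * t); intros i Hi; apply ilt_succ_r in Hi as [Hi| ->]; [|now exists x].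
        destruct (Ha i Hi) as (y & Hy & [[q Hq] Hlt]), (Hp i Hi) as [e He].
        exists y; split; [assumption|]; split; [|assumption].
        exists (q + e * t); rewrite Hq, He; unfold modulus; ring. }
  destruct (Hcode l (ilt_irrefl l)) as [a Ha].
  exists (ipair l (ipair a b)); split; [now exists a, b|].
  intros i x (l' & a' & b' & E & Hi & Hx).
  apply ipair_inj in E as [<- E]; apply ipair_inj in E as [<- <-].
  destruct (Ha i Hi) as (y & Hy & Hby).
  now rewrite (ibeta_functional _ _ _ _ _ Hx Hby).
Qed.

(** Induction on the number of steps. A beta code cannot be extended in place, so each step recodes
    the old sequence with one more entry by [comprehension]. *)
Theorem recursion (G : M -> M -> M -> Prop) (x0 l : M) :
  definable (fun rho => G (rho 0%nat) (rho 1%nat) (rho 2%nat)) ->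
  (forall i x, i < l -> exists y, G i x y) ->
  exists u, ilh u (isucc l) /\ ientry u 0 x0 /\
    forall i x y, ientry u i x -> ientry u (isucc i) y -> G i x y.
Proof.
  intro HG; induct l; intro Hex.
  - destruct (comprehension (fun _ x => x = x0) (isucc 0)) as (u & Hu & HR).
    + definability.
    + intros; now exists x0.
    + exists u; split; [assumption|]; split.
      * destruct (ientry_total u _ 0 Hu (ilt_succ_diag 0)) as [x Hx].
        now rewrite <- (HR _ _ Hx).
      * intros i x y _ Hy; apply (ientry_ilt _ _ _ _ Hu) in Hy.
        now apply ilt_succ_succ, not_ilt_0 in Hy.
  - destruct IH as (u & Hu & Hu0 & HuG).
    { intros i x Hi; apply Hex, ilt_succ_r; now left. }
    destruct (ientry_total u _ l Hu (ilt_succ_diag l)) as [x Hx].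
    destruct (Hex l x (ilt_succ_diag l)) as [y Hy].
    destruct (comprehension (fun i z => ientry u i z \/ (i = isucc l /\ z = y))
      (isucc (isucc l))) as (u' & Hu' & HR).
    + definability.
    + intros i Hi; apply ilt_succ_r in Hi as [Hi| ->]; [|exists y; now right].
      destruct (ientry_total u _ i Hu Hi) as [z Hz]; exists z; now left.
    + assert (Hold : forall i z, i < isucc l -> ientry u' i z -> ientry u i z).
      { intros i z Hi Hz; destruct (HR i z Hz) as [H|[-> _]]; [assumption|].
        now apply ilt_irrefl in Hi. }
      exists u'; split; [assumption|]; split.
      * destruct (ientry_total u' _ 0 Hu' (ilt_0_succ _)) as [z Hz].
        assert (H := Hold 0 z (ilt_0_succ _) Hz).
        now rewrite (ientry_functional _ _ _ _ Hu0 H).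
      * intros i z w Hz Hw; destruct (HR _ _ Hw) as [H|[E ->]].
        -- apply HuG; [apply Hold|]; try assumption.
           apply ilt_trans with (isucc i); [apply ilt_succ_diag|].
           now apply (ientry_ilt _ _ _ _ Hu) in H.
        -- apply isucc_inj in E as ->.
           apply Hold in Hz; [|apply ilt_succ_diag].
           now rewrite (ientry_functional _ _ _ _ Hz Hx).
Qed.


(** * Closure properties of coded sentences *)

Lemma inum_inj (a b : nat) : @inum M a = inum b -> a = b.
Proof.
  revert b; induction a as [|a IH]; intros [|b] H; simpl in H.
  - reflexivity.
  - symmetry in H; now apply isucc_nonzero in H.
  - now apply isucc_nonzero in H.
  - f_equal; apply IH, isucc_inj, H.
Qed.

Lemma ilt_add_split x y : x < y \/ exists z, x = y + z.
Proof.
  destruct (ilt_total x y) as [H|[->|[z <-]]]; [now left| |]; right.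
  - exists 0; ring.
  - now exists (isucc z).
Qed.

Lemma ilt_iadd_r x y z : x < y -> x < y + z.
Proof. intros [u <-]; exists (u + z); ring. Qed.

(* The new sequence concatenates the two given ones and ends with [z]. *)
Lemma ibuilt_binary (step : (M -> Prop) -> M -> Prop) x y z :
  (forall P Q : M -> Prop, (forall w, P w -> Q w) -> forall w, step P w -> step Q w) ->
  ibuilt step x -> ibuilt step y ->
  (forall P : M -> Prop, P x -> P y -> step P z) -> ibuilt step z.
Proof.
  intros Hmono (s & l & Hs & Hx & Hstep) (s' & l' & Hs' & Hy & Hstep') Hz.
  set (n := isucc l + isucc l').
  assert (Hsn : forall i w, ientry s i w -> i < isucc n).
  { intros i w Hw; apply (ientry_ilt _ _ _ _ Hs) in Hw.
    replace (isucc n) with (isucc l + isucc (isucc l')) by (unfold n; ring).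
    now apply ilt_iadd_r. }
  assert (Hsn' : forall i w, ientry s' i w -> isucc l + i < isucc n).
  { intros i w Hw; apply (ientry_ilt _ _ _ _ Hs') in Hw as [d Hd].
    exists (isucc d); unfold n; rewrite <- Hd; ring. }
  destruct (comprehension (fun i w => ientry s i w
    \/ (exists j, i = isucc l + j /\ ientry s' j w) \/ (i = n /\ w = z)) (isucc n))
    as (u & Hu & HR).
  { definability. }
  { intros i Hi; destruct (ilt_add_split i (isucc l)) as [H|[j ->]].
    - destruct (ientry_total s _ i Hs H) as [w Hw]; exists w; now left.
    - destruct (ilt_add_split j (isucc l')) as [K|[d ->]].
      + destruct (ientry_total s' _ j Hs' K) as [w Hw]; exists w; right; left; now exists j.
      + exists z; right; right; split; [|reflexivity].
        apply ilt_succ_r in Hi as [[e He]|Hi]; [|assumption].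
        exfalso; apply (iadd_succ_neq n (d + e)); rewrite <- He at 1; unfold n; ring. }
  assert (Hleft : forall i w, ientry s i w -> ientry u i w).
  { intros i w Hw; destruct (ientry_total u _ i Hu (Hsn i w Hw)) as [w' Hw'].
    assert (Hi := ientry_ilt _ _ _ _ Hs Hw).
    destruct (HR i w' Hw') as [H|[(j & -> & _)|[-> _]]].
    - now rewrite (ientry_functional _ _ _ _ Hw H).
    - destruct Hi as [d Hd]; exfalso; apply (iadd_succ_neq (isucc l) (j + d)).
      rewrite <- Hd at 1; ring.
    - destruct Hi as [d Hd]; exfalso; apply (iadd_succ_neq (isucc l) (isucc (l' + d))).
      rewrite <- Hd at 1; unfold n; ring. }
  assert (Hright : forall i w, ientry s' i w -> ientry u (isucc l + i) w).
  { intros i w Hw; destruct (ientry_total u _ (isucc l + i) Hu (Hsn' i w Hw)) as [w' Hw'].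
    assert (Hi := ientry_ilt _ _ _ _ Hs' Hw).
    destruct (HR _ w' Hw') as [H|[(j & E & H)|[E _]]].
    - apply (ientry_ilt _ _ _ _ Hs) in H as [d Hd].
      exfalso; apply (iadd_succ_neq (isucc l) (i + d)); rewrite <- Hd at 1; ring.
    - apply iadd_cancel_l in E as ->; now rewrite (ientry_functional _ _ _ _ Hw H).
    - apply iadd_cancel_l in E as ->; now apply ilt_irrefl in Hi. }
  assert (Hlast : ientry u n z).
  { destruct (ientry_total u _ n Hu (ilt_succ_diag n)) as [w Hw].
    destruct (HR _ w Hw) as [H|[(j & E & H)|[_ <-]]]; [| |assumption]; exfalso.
    - apply (ientry_ilt _ _ _ _ Hs) in H as [d Hd].
      apply (iadd_succ_neq (isucc l) (isucc (l' + d))); rewrite <- Hd at 1; unfold n; ring.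
    - apply (ientry_ilt _ _ _ _ Hs') in H.
      apply iadd_cancel_l in E as <-; now apply ilt_irrefl in H. }
  exists u, n; split; [assumption|]; split; [assumption|].
  (* Copied entries remain justified because [step] is monotone and the copies of their predecessors
     still come earlier. For [z], the components sit at positions l and (l + 1) + l'. *)
  intros i w; apply iimpE; intro Hw; destruct (HR i w Hw) as [H|[(j & -> & H)|[-> ->]]].
  - apply (proj1 (iimpE _ _) (Hstep i w)) in H; revert H; apply Hmono.
    intros w' (k & Hk & Hw'); exists k; auto.
  - apply (proj1 (iimpE _ _) (Hstep' j w)) in H; revert H; apply Hmono.
    intros w' (k & [d <-] & Hw'); exists (isucc l + k); split; [exists d; ring | auto].
  - apply Hz.
    + exists l; split; [exists (isucc l'); unfold n; ring | auto].
    + exists (isucc l + l'); split; [exists 0; unfold n; ring | auto].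
Qed.

Lemma form_step_mono (P Q : M -> Prop) :
  (forall w, P w -> Q w) -> forall w, form_step P w -> form_step Q w.
Proof.
  intros H w [Hw|[(y & Hy & ->)|[(y & z & Hy & Hz & Hw)|(v & y & Hv & Hy & Hw)]]].
  - now left.
  - right; left; exists y; auto.
  - right; right; left; exists y, z; auto.
  - right; right; right; exists v, y; auto.
Qed.

Lemma iis_form_neg x : iis_form x -> iis_form (icneg x).
Proof.
  intro H; apply (ibuilt_binary form_step x x _ form_step_mono); auto.
  intros P HP _; right; left; now exists x.
Qed.

Lemma iis_form_or x y : iis_form x -> iis_form y -> iis_form (icor x y).
Proof.
  intros Hx Hy; apply (ibuilt_binary form_step x y _ form_step_mono); auto.
  intros P HP HQ; right; right; left; exists x, y; auto.
Qed.

Lemma iis_form_and x y : iis_form x -> iis_form y -> iis_form (icand x y).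
Proof.
  intros Hx Hy; apply (ibuilt_binary form_step x y _ form_step_mono); auto.
  intros P HP HQ; right; right; left; exists x, y; auto.
Qed.

(** * Free variables and sentences *)

Lemma ifree_in_step v x : iis_var v -> ~ iis_var x -> ifree_in v x ->
  exists y, ibelow_avoiding v x y /\ ifree_in v y.
Proof.
  intros Hv Hx (s & l & Hs & H0 & Hl & Hpath).
  (* A path with a single node would make [x] the variable [v]. Otherwise its second node is the
     required [y], and the path without its head witnesses that [v] is free in [y]. *)
  destruct (zero_or_isucc l) as [->|[k ->]].
  { now rewrite (ientry_functional _ _ _ _ H0 Hl) in Hx. }
  destruct (ientry_total s _ (isucc 0) Hs) as [y Hy].
  { apply ilt_succ_succ, ilt_0_succ. }
  exists y; split; [exact (proj1 (iimpE _ _) (Hpath 0 x y) (conj H0 Hy))|].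
  destruct (comprehension (fun i w => ientry s (isucc i) w) (isucc k)) as (u & Hu & HR).
  { definability. }
  { intros i Hi; apply (ientry_total s _ _ Hs); now apply ilt_succ_succ. }
  assert (Htail : forall i w, i < isucc k -> ientry s (isucc i) w -> ientry u i w).
  { intros i w Hi Hw; destruct (ientry_total u _ i Hu Hi) as [w' Hw'].
    now rewrite (ientry_functional _ _ _ _ Hw (HR _ _ Hw')). }
  exists u, k; split; [assumption|]; split; [|split].
  - apply Htail; [apply ilt_0_succ | assumption].
  - apply Htail; [apply ilt_succ_diag | assumption].
  - intros i w w'; apply iimpE; intros [Hw Hw'].
    apply (proj1 (iimpE _ _) (Hpath (isucc i) w w')); auto.
Qed.

Ltac unpair :=
  repeat match goal with
  | H : ipair _ _ = ipair _ _ |- _ => apply ipair_inj in H as [? ?]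
  | H : inum _ = inum _ |- _ => apply inum_inj in H; try discriminate H; clear H
  end.

Ltac below_cases H :=
  destruct H as [H|[H|[[? H]|(? & _ & H)]]];
  repeat (destruct H as [H|H]);
  unfold icsucc, icadd, icmul, iceq, icneg, icor, icand, icex, icall in H;
  unpair; subst; auto.

Lemma ibelow_neg v x y : ibelow_avoiding v (icneg x) y -> y = x.
Proof. intro H; below_cases H. Qed.

Lemma ibelow_or v x y z : ibelow_avoiding v (icor x y) z -> z = x \/ z = y.
Proof. intro H; below_cases H. Qed.

Lemma ibelow_and v x y z : ibelow_avoiding v (icand x y) z -> z = x \/ z = y.
Proof. intro H; below_cases H. Qed.

Lemma iis_sent_by x : iis_form x -> ~ iis_var x ->
  (forall v y, ibelow_avoiding v x y -> iis_sent y) -> iis_sent x.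
Proof.
  intros Hf Hx Hb; split; [assumption|]; intro v; apply iimpE; intros Hv Hfree.
  destruct (ifree_in_step v x Hv Hx Hfree) as (y & Hy & Hvy).
  destruct (Hb v y Hy) as [_ H]; exact (proj1 (iimpE _ _) (H v) Hv Hvy).
Qed.

Lemma iis_sent_neg x : iis_sent x -> iis_sent (icneg x).
Proof.
  intro H; apply iis_sent_by.
  - now apply iis_form_neg, H.
  - intros [i Hi]; unfold icneg, icvar in Hi; unpair.
  - intros v y Hy; now apply ibelow_neg in Hy as ->.
Qed.

Lemma iis_sent_or x y : iis_sent x -> iis_sent y -> iis_sent (icor x y).
Proof.
  intros Hx Hy; apply iis_sent_by.
  - now apply iis_form_or; [apply Hx | apply Hy].
  - intros [i Hi]; unfold icor, icvar in Hi; unpair.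
  - intros v z Hz; now apply ibelow_or in Hz as [->| ->].
Qed.

Lemma iis_sent_and x y : iis_sent x -> iis_sent y -> iis_sent (icand x y).
Proof.
  intros Hx Hy; apply iis_sent_by.
  - now apply iis_form_and; [apply Hx | apply Hy].
  - intros [i Hi]; unfold icand, icvar in Hi; unpair.
  - intros v z Hz; now apply ibelow_and in Hz as [->| ->].
Qed.

(** * Truth, sequential induction and disjunctions *)

Hypothesis M_CT : models M CT_minus.

Lemma itr_neg x : iis_sent x -> (itr (icneg x) <-> ~ itr x).
Proof.
  intro Hx; assert (H : @sat M (fun _ => 0) CT_neg).
  { apply M_CT; right; simpl; auto 10. }
  change (forall x : M, iimp (iis_sent x) (iiff (itr (icneg x)) (~ itr x))) in H.
  assert (K := proj1 (iimpE _ _) (H x) Hx); unfold iiff in K; now rewrite !iimpE in K.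
Qed.

Lemma itr_or x y : iis_sent x -> iis_sent y -> (itr (icor x y) <-> itr x \/ itr y).
Proof.
  intros Hx Hy; assert (H : @sat M (fun _ => 0) CT_or).
  { apply M_CT; right; simpl; auto 10. }
  change (forall x y : M, iimp (iis_sent x /\ iis_sent y)
    (iiff (itr (icor x y)) (itr x \/ itr y))) in H.
  assert (K := proj1 (iimpE _ _) (H x y) (conj Hx Hy)).
  unfold iiff in K; now rewrite !iimpE in K.
Qed.

Lemma itr_and x y : iis_sent x -> iis_sent y -> (itr (icand x y) <-> itr x /\ itr y).
Proof.
  intros Hx Hy; assert (H : @sat M (fun _ => 0) CT_and).
  { apply M_CT; right; simpl; auto 10. }
  change (forall x y : M, iimp (iis_sent x /\ iis_sent y)
    (iiff (itr (icand x y)) (itr x /\ itr y))) in H.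
  assert (K := proj1 (iimpE _ _) (H x y) (conj Hx Hy)).
  unfold iiff in K; now rewrite !iimpE in K.
Qed.

Definition sentence_sequence s : Prop := forall i x, ientry s i x -> iis_sent x.

(** The meeting point of the two hypotheses: [DC_out] speaks of sequences of sentences only, and
    partial disjunctions form such sequences. *)
Definition sentence_seqind : Prop := forall s l, ilh s l -> sentence_sequence s ->
  iT_entry s 0 ->
  (forall i, isucc i < l -> iT_entry s i -> iT_entry s (isucc i)) ->
  forall j, j < l -> iT_entry s j.

Definition disjunctive_correctness_out : Prop := forall s, (exists l, ilh s l) ->
  sentence_sequence s -> iT_disjunction s -> exists i, iT_entry s i.

Definition disjunctive_correctness_in : Prop := forall s, (exists l, ilh s l) ->
  sentence_sequence s -> (exists i, iT_entry s i) -> iT_disjunction s.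

Lemma iseq_ofE s :
  iseq_of iis_sent s <-> (exists l, ilh s l) /\ sentence_sequence s.
Proof.
  split; intros [Hl H]; (split; [assumption|]); intros i x;
    [apply iimpE, H | apply iimpE; intro Hx; exact (H i x Hx)].
Qed.

Lemma sat_DC_out (rho : nat -> M) : sat rho DC_out <-> disjunctive_correctness_out.
Proof.
  change (sat rho DC_out) with (forall s : M, iimp (iseq_of iis_sent s)
    (iimp (iT_disjunction s) (exists i, iT_entry s i))).
  split; intros H s; specialize (H s).
  - rewrite !iimpE, iseq_ofE in H; auto.
  - rewrite !iimpE, iseq_ofE; intros []; auto.
Qed.

Lemma sat_DC_in (rho : nat -> M) : sat rho DC_in <-> disjunctive_correctness_in.
Proof.
  change (sat rho DC_in) with (forall s : M, iimp (iseq_of iis_sent s)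
    (iimp (exists i, iT_entry s i) (iT_disjunction s))).
  split; intros H s; specialize (H s).
  - rewrite !iimpE, iseq_ofE in H; auto.
  - rewrite !iimpE, iseq_ofE; intros []; auto.
Qed.

Lemma sat_SeqInd (rho : nat -> M) : sat rho SeqInd -> sentence_seqind.
Proof.
  change (sat rho SeqInd) with (forall s l : M, iimp (ilh s l)
    (iimp (iT_entry s 0 /\
           forall i, iimp (isucc i < l) (iimp (iT_entry s i) (iT_entry s (isucc i))))
       (forall j, iimp (j < l) (iT_entry s j)))).
  intros H s l Hl _ H0 HS j; specialize (H s l); rewrite !iimpE in H.
  apply iimpE, H; [assumption|]; split; [assumption|].
  intro i; rewrite !iimpE; auto.
Qed.

(** Being a sentence is arithmetical, so it propagates along a sequence of any length by induction,
    unlike truth. *)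
Lemma sentences_by_recursion (G : M -> M -> M -> Prop) u l :
  ilh u l -> (forall x, ientry u 0 x -> iis_sent x) ->
  (forall i x y, ientry u i x -> ientry u (isucc i) y -> G i x y) ->
  (forall i x y, iis_sent x -> G i x y -> iis_sent y) -> sentence_sequence u.
Proof.
  intros Hu H0 HG HS i; induct i; [assumption|]; intros y Hy.
  assert (Hi : i < l).
  { apply ilt_trans with (isucc i); [apply ilt_succ_diag|].
    now apply (ientry_ilt _ _ _ _ Hu) in Hy. }
  destruct (ientry_total u l i Hu Hi) as [x Hx]; eapply HS; eauto.
Qed.

(* E i is true as soon as s (j - i) is, because of its last disjunct alone, without any
   induction.  A true disjunct s (j - i - 1) /\ ~ E i yields s (j - i), hence E i. *)
Theorem DC_out_sentence_seqind : disjunctive_correctness_out -> sentence_seqind.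
Proof.
  intros HDC s l Hs Hsent H0 Hstep j Hj; apply NNPP; intro Hfalse.
  destruct (ientry_total s l j Hs Hj) as [sj Hsj].
  (* The entry s_(j-i), with the subtraction expressed as k + i = j. *)
  set (back i z := exists k, k + i = j /\ ientry s k z).
  assert (Hback : forall i, i < isucc j -> exists z, back i z).
  { intros i Hi; assert (Hk : exists k, k + i = j).
    { apply ilt_succ_r in Hi as [[d <-]| ->]; [exists (isucc d) | exists 0]; ring. }
    destruct Hk as [k Hk], (ientry_total s l k Hs) as [z Hz]; [|now exists z, k].
    destruct (ilt_add_split k l) as [|[d ->]]; [assumption|].
    exfalso; apply (ilt_irrefl l); rewrite <- Hk in Hj.
    destruct Hj as [e He]; exfalso; apply (iadd_succ_neq l (d + i + e)).
    rewrite <- He at 1; ring. }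
  assert (Hbacksent : forall i z, back i z -> iis_sent z).
  { intros i z (k & _ & Hz); eapply Hsent; eassumption. }
  assert (Hbackfun : forall i z z', back i z -> back i z' -> z = z').
  { intros i z z' (k & Hk & Hz) (k' & Hk' & Hz').
    rewrite <- Hk', !(iadd_comm _ i) in Hk; apply iadd_cancel_l in Hk as ->.
    eapply ientry_functional; eassumption. }
  destruct (recursion (fun i x y => exists z, back (isucc i) z /\ y = icor x (icand z (icneg x)))
    sj j) as (E & HE & HE0 & HES).
  { definability. }
  { intros i x Hi; destruct (Hback (isucc i)) as [z Hz]; [now apply ilt_succ_succ|].
    eexists; eauto. }
  assert (HEsent : sentence_sequence E).
  { apply (sentences_by_recursion _ E _ HE) with (2 := HES).
    - intros x Hx; rewrite (ientry_functional _ _ _ _ Hx HE0); eapply Hsent; eassumption.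
    - intros i x y Hx (z & Hz & ->).
      apply iis_sent_or, iis_sent_and, iis_sent_neg; eauto. }
  assert (HET : forall i e z, ientry E i e -> back i z -> itr z -> itr e).
  { intros i e z He Hz HT; destruct (zero_or_isucc i) as [->|[k ->]].
    (* At i = 0 the entry is s_j itself, which is not true by assumption. *)
    - destruct Hz as (m & Hm & Hz); rewrite iadd_0_r in Hm; subst m.
      exfalso; apply Hfalse; now exists z.
    - destruct (ientry_total E _ k HE) as [x Hx].
      { apply ilt_trans with (isucc k); [apply ilt_succ_diag|].
        now apply (ientry_ilt _ _ _ _ HE) in He. }
      destruct (HES k x e Hx He) as (z' & Hz' & ->).
      rewrite (Hbackfun _ _ _ Hz' Hz) in *.
      assert (Sx : iis_sent x) by eauto; assert (Sz : iis_sent z) by eauto.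
      rewrite itr_or, itr_and, itr_neg by auto using iis_sent_and, iis_sent_neg.
      (* Either the left disjunct [x] is true, or its negation is, and then the right disjunct is
         true with [z]. *)
      destruct (classic (itr x)); auto. }
  (* [psi] lists the disjuncts of E_j; the index shift leaves position 0 to s_j. *)
  destruct (comprehension (fun i w => (i = 0 /\ w = sj) \/
    exists k e z, i = isucc k /\ ientry E k e /\ back i z /\ w = icand z (icneg e))
    (isucc j)) as (psi & Hpsi & HR).
  { definability. }
  { intros i Hi; destruct (zero_or_isucc i) as [->|[k ->]]; [exists sj; now left|].
    destruct (ientry_total E _ k HE) as [e He].
    { apply ilt_trans with (isucc k); [apply ilt_succ_diag | assumption]. }
    destruct (Hback _ Hi) as [z Hz].
    exists (icand z (icneg e)); right; exists k, e, z; auto. }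
  destruct (HDC psi) as [i (w & Hw & HT)].
  - now exists (isucc j).
  - intros i w Hw; destruct (HR i w Hw) as [[_ ->]|(k & e & z & _ & He & Hz & ->)].
    + eapply Hsent; eassumption.
    + apply iis_sent_and, iis_sent_neg; eauto.
  - destruct (ientry_total E _ j HE (ilt_succ_diag j)) as [d Hd]; exists d; split.
    (* The sequence [E] itself serves as the partial disjunctions of [psi]. *)
    + exists j, E; split; [assumption|]; split; [assumption|]; split; [|split; [|assumption]].
      * exists sj; split; [|assumption].
        destruct (ientry_total psi _ 0 Hpsi (ilt_0_succ j)) as [w Hw].
        destruct (HR 0 w Hw) as [[_ <-]|(k & _ & _ & K & _)]; [assumption|].
        symmetry in K; now apply isucc_nonzero in K.
      * intros i x y; apply iimpE; intros [Hx Hy].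
        destruct (ientry_total E _ (isucc i) HE) as [y' Hy'].
        { now apply (ientry_ilt _ _ _ _ Hpsi) in Hy. }
        destruct (HES i x y' Hx Hy') as (z & Hz & ->).
        destruct (HR _ _ Hy) as [[K _]|(k & e & z' & K & He & Hz' & ->)].
        { now apply isucc_nonzero in K. }
        apply isucc_inj in K as <-.
        now rewrite (ientry_functional _ _ _ _ He Hx), (Hbackfun _ _ _ Hz' Hz).
    + destruct H0 as (s0 & Hs0 & HT0); apply (HET j d s0); [assumption| |assumption].
      exists 0; split; [ring | assumption].
  - destruct (HR i w Hw) as [[_ ->]|(k & e & z & -> & He & Hz & ->)].
    + apply Hfalse; now exists sj.
    + assert (Se : iis_sent e) by eauto; assert (Sz : iis_sent z) by eauto.
      rewrite itr_and, itr_neg in HT by auto using iis_sent_neg.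
      destruct HT as [HTz HTe], Hz as (m & Hm & Hz).
      assert (Hm' : isucc m + k = j) by (rewrite <- Hm; ring).
      destruct (Hstep m) as (z' & Hz' & HTz').
      * destruct (ilt_add_split (isucc m) l) as [|[d Hd]]; [assumption|].
        destruct Hj as [c Hc]; exfalso; apply (iadd_succ_neq l (d + k + c)).
        rewrite <- Hc at 1; rewrite <- Hm', Hd; ring.
      * now exists z.
      * apply HTe, (HET k e z'); [assumption| |assumption].
        now exists (isucc m).
Qed.

Theorem sentence_seqind_DC_in : sentence_seqind -> disjunctive_correctness_in.
Proof.
  intros HSI s [l Hs] Hsent [k (sk & Hsk & HTk)].
  assert (Hk := ientry_ilt _ _ _ _ Hs Hsk).
  assert (Hc : exists r, l = isucc (k + r)).
  { destruct Hk as [r <-]; exists r; ring. }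
  (* [c] is the last index of [s], and [r] is the number of steps from the true disjunct at [k] to
     it. *)
  destruct Hc as [r ->]; set (c := k + r) in *.
  destruct (ientry_total s _ 0 Hs (ilt_0_succ c)) as [s0 Hs0].
  destruct (recursion (fun i x y => exists z, ientry s (isucc i) z /\ y = icor x z) s0 c)
    as (u & Hu & Hu0 & HuS).
  { definability. }
  { intros i x Hi; destruct (ientry_total s _ (isucc i) Hs) as [z Hz];
      [now apply ilt_succ_succ | eexists; eauto]. }
  assert (Husent : sentence_sequence u).
  { apply (sentences_by_recursion _ u _ Hu) with (2 := HuS).
    - intros x Hx; rewrite (ientry_functional _ _ _ _ Hx Hu0); eapply Hsent; eassumption.
    - intros i x y Hx (z & Hz & ->); apply iis_sent_or; eauto. }
  assert (HuT : forall i x y z, ientry u i x -> ientry u (isucc i) y ->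
    ientry s (isucc i) z -> (itr y <-> itr x \/ itr z)).
  { intros i x y z Hx Hy Hz; destruct (HuS i x y Hx Hy) as (z' & Hz' & ->).
    rewrite (ientry_functional _ _ _ _ Hz' Hz); apply itr_or; eauto. }
  destruct (ientry_total u _ c Hu (ilt_succ_diag c)) as [d Hd].
  exists d; split.
  - exists c, u; split; [assumption|]; split; [assumption|]; split; [|split; [|assumption]].
    + now exists s0.
    + intros i x y; apply iimpE; intros [Hx Hy].
      destruct (ientry_total u _ (isucc i) Hu) as [w Hw].
      { now apply (ientry_ilt _ _ _ _ Hs) in Hy. }
      destruct (HuS i x w Hx Hw) as (z & Hz & ->).
      now rewrite (ientry_functional _ _ _ _ Hy Hz).
  (* Sequential induction starts at index 0, so the tail of [u] from [k] on is recoded. Along it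
     truth passes upwards through left disjuncts. *)
  - destruct (comprehension (fun i x => ientry u (k + i) x) (isucc r)) as (t & Ht & HR).
    { definability. }
    { intros i [e He]; apply (ientry_total u _ _ Hu); exists e; unfold c.
      replace (isucc (k + r)) with (k + isucc r) by ring; rewrite <- He; ring. }
    destruct (HSI t (isucc r) Ht) with (j := r) as (x & Hx & HTx).
    + intros i x Hx; eapply Husent; eauto.
    + destruct (ientry_total t _ 0 Ht (ilt_0_succ r)) as [x Hx].
      exists x; split; [assumption|]; apply HR in Hx; rewrite iadd_0_r in Hx.
      (* For k = 0 the first partial disjunction is s_0 itself; otherwise s_k is the right disjunct
         of u_k. *)
      destruct (zero_or_isucc k) as [E|[k' E]]; rewrite E in *.
      * rewrite (ientry_functional _ _ _ _ Hx Hu0).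
        now rewrite (ientry_functional _ _ _ _ Hs0 Hsk).
      * destruct (ientry_total u _ k' Hu) as [y Hy].
        { apply ilt_trans with (isucc k'); [apply ilt_succ_diag | assumption]. }
        apply (HuT k' y x sk Hy Hx Hsk); now right.
    + intros i Hi (x & Hx & HTx).
      destruct (ientry_total t _ _ Ht Hi) as [y Hy]; exists y; split; [assumption|].
      apply HR in Hx, Hy; rewrite iadd_succ_r in Hy.
      destruct (ientry_total s _ (isucc (k + i)) Hs) as [z Hz].
      { now apply (ientry_ilt _ _ _ _ Hu) in Hy. }
      apply (HuT (k + i) x y z Hx Hy Hz); now left.
    + apply ilt_succ_diag.
    + apply HR in Hx; now rewrite (ientry_functional _ _ _ _ Hd Hx).
Qed.

End Models.

(** * From models to theories *)

Lemma PA_closed (A : form) : PA A -> form_below 0 A.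
Proof.
  assert (Hiter : forall k m B, form_below (k + m) B -> form_below m (Nat.iter k All B)).
  { induction k as [|k IH]; simpl; [trivial|]; intros m B HB.
    apply IH; now rewrite Nat.add_succ_r. }
  destruct 1 as [| | | | | |k A _ HA]; try (simpl; repeat split; lia).
  apply Hiter; rewrite Nat.add_0_r; simpl.
  repeat split; try assumption.
  - eapply fsubst_form_below; [|exact HA]; intros [|n] Hn; simpl; [exact I | lia].
  - eapply fsubst_form_below; [|exact HA]; intros [|n] Hn; simpl; lia.
Qed.

(** Read off at depth 0, every [level] computes to a concrete index, so closedness reduces to
    numerical inequalities. *)
Lemma CT_minus_closed (A : form) : CT_minus A -> form_below 0 A.
Proof.
  intros [HA|HA]; [now apply PA_closed|].
  simpl in HA; repeat destruct HA as [<-|HA]; try contradiction HA;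
    cbn; repeat split; lia.
Qed.

Lemma DC_out_closed : form_below 0 DC_out.
Proof. cbn; repeat split; lia. Qed.

Lemma DC_in_closed : form_below 0 DC_in.
Proof. cbn; repeat split; lia. Qed.

Lemma SeqInd_closed : form_below 0 SeqInd.
Proof. cbn; repeat split; lia. Qed.

Lemma CT_minus_PA (M : structure) : models M CT_minus -> models M PA.
Proof. intros H A HA; apply H; now left. Qed.

Theorem SeqInd_proves_DC_in : proves (extend CT_minus SeqInd) DC_in.
Proof.
  apply completeness.
  - intros A [HA| ->]; [now apply CT_minus_closed | apply SeqInd_closed].
  - apply DC_in_closed.
  - intros M HM rho.
    assert (HCT : models M CT_minus) by (intros A HA; apply HM; now left).
    assert (HPA := CT_minus_PA M HCT).
    apply sat_DC_in, sentence_seqind_DC_in; try assumption.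
    apply (sat_SeqInd rho), HM; now right.
Qed.

(** The semantic work yields one provable equivalence; that the two extensions have the same
    theorems is then a matter of modus ponens. *)
Theorem DC_out_equiv_DC : proves CT_minus (Iff DC_out DC).
Proof.
  apply completeness.
  - exact CT_minus_closed.
  - assert (Ho := DC_out_closed); assert (Hi := DC_in_closed).
    cbn [form_below Iff Imp DC]; tauto.
  - intros M HM rho; assert (HPA := CT_minus_PA M HM).
    change (iiff (sat rho DC_out) (sat rho DC_out /\ sat rho DC_in)).
    unfold iiff; rewrite !iimpE; split; [intro H; split; [assumption|] | now intros []].
    apply sat_DC_in, sentence_seqind_DC_in; try assumption.
    apply DC_out_sentence_seqind; try assumption.
    now apply (sat_DC_out rho).
Qed.

Lemma proves_mp (U : theory) (A B : form) : proves U (Imp A B) -> proves U A -> proves U B.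
Proof.
  apply proves_from2, d_orE with (Neg A) B.
  - apply d_ass; simpl; auto.
  - apply derives_explode with A; apply d_ass; simpl; auto.
  - apply d_ass; simpl; auto.
Qed.

Lemma proves_extend_equiv (U : theory) (A B C : form) :
  proves U (Imp B A) -> proves (extend U A) C -> proves (extend U B) C.
Proof.
  intros HBA; apply proves_cut; intros D [HD| ->]; [apply proves_ass; now left|].
  apply proves_mp with B; [|apply proves_ass; now right].
  revert HBA; apply proves_cut; intros D HD; apply proves_ass; now left.
Qed.

Theorem theorem3p3 :
  proves (extend CT_minus SeqInd) DC_in
  /\ proves CT_minus (Iff DC_out DC)
  /\ (forall A : form,
        proves (extend CT_minus DC_out) A <-> proves (extend CT_minus DC) A).
Proof.
  split; [exact SeqInd_proves_DC_in|]; split; [exact DC_out_equiv_DC|].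
  intro A; split; apply proves_extend_equiv;
    apply (proves_from1 _ _ _) with (2 := DC_out_equiv_DC).
  - apply d_andE2 with (Imp DC_out DC), d_ass; now left.
  - apply d_andE1 with (Imp DC DC_out), d_ass; now left.
Qed.
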